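(* Let $P$ be an $A$-hyperdefinable set. Then $P$ with the $A$-logic topology admits a unique uniform structure, and the family $\mathcal{E}_P(A)$ of positive $\bigwedge_A$-definable binary relations on $P$ is a uniformity base of it.
   Context: Fix a first-order many-sorted language $\mathcal{L}$ and a $\kappa$-saturated, strongly $\kappa$-homogeneous $\mathcal{L}$-structure $\mathfrak{M}$, with $\kappa>|\mathcal{L}|$ a strong limit cardinal; ''small'' means of cardinality $<\kappa$. A hyperdefinable set is a quotient $P=X/E$ of a nonempty type-definable set $X$ by a type-definable equivalence relation $E$; elements are hyperimaginaries. $A$ is a small set of hyperimaginaries; $P$ is $A$-hyperdefinable if $X,E$ are $\mathrm{Aut}(\mathfrak{M}/A)$-invariant; a subset of $P$ (or of $P\times P=(X\times X)/(E\times E)$) is $\bigwedge_A$-definable if its preimage is type-definable and $\mathrm{Aut}(\mathfrak{M}/A)$-invariant. The $A$-logic topology on $P$ has as closed sets the $\bigwedge_A$-definable subsets. For $a\in P$, $\mathrm{tp}(a/A)$ is the orbit of $a$ under $\mathrm{Aut}(\mathfrak{M}/A)$, and $\Delta_P(A)=\{(a,b)\in P\times P:\mathrm{tp}(a/A)=\mathrm{tp}(b/A)\}$. An $\bigwedge_A$-definable binary relation $\varepsilon\subseteq P\times P$ is positive if $\Delta_P(A)$ is contained in the interior of $\varepsilon$ with respect to the product topology of the $A$-logic topologies. A uniform structure on a set $X$ is a filter $\Phi$ of binary relations such that each $U\in\Phi$ contains the diagonal, $U^{-1}\in\Phi$, and there is $V\in\Phi$ with $V\circ V\subseteq U$; it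 induces the topology with neighbourhood bases $\{U(a):U\in\Phi\}$, $U(a)=\{b:(a,b)\in U\}$; a topology admits a uniform structure if some uniform structure induces it; a uniformity base is a filter base of $\Phi$.
   Formalization: Besides |A|<κ, representatives of A are assumed to have total length <κ, and the sets X, E whose classes form A to be type-definable over a small set of real elements fixed by Aut(M/A) (automatic for κ regular and X, E over the empty set); the claim fails otherwise. *)

(* Defs.v *)
From mathcomp Require Import all_boot all_classical.
From mathcomp Require Import uniform_structure.
Set Implicit Arguments.
Unset Strict Implicit.
Unset Printing Implicit Defensive.
Local Open Scope classical_set_scope.
Local Open Scope card_scope.
Local Open Scope relation_scope.

(** Many-sorted first-order logic. *)

Record language := Language {
  lsort : Type;
  fsym : Type;
  farity : fsym -> nat;
  fdom : forall f, 'I_(farity f) -> lsort;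
  fcod : fsym -> lsort;
  rsym : Type;
  rarity : rsym -> nat;
  rdom : forall r, 'I_(rarity r) -> lsort }.

(* The number of L-formulas is |symbols of L| = max(aleph_0, |sorts| + |function
   symbols| + |relation symbols|); a set of this cardinality stands for |L|. *)
Definition symbols (L : language) : Type :=
  (nat + (lsort L + (fsym L + rsym L)))%type.

Section Syntax.
Variable L : language.

(* A context is a type V of variables with a sort c v for each v : V.  Terms and
   formulas over it have their free variables in V. *)
Inductive term (V : Type) (c : V -> lsort L) : lsort L -> Type :=
| Var (v : V) : term c (c v)
| App (f : fsym L) (ts : forall i : 'I_(farity f), term c (fdom i)) :
    term c (fcod f).

Definition ext (V : Type) (c : V -> lsort L) (s : lsort L)
  (o : option V) : lsort L := if o is Some v then c v else s.

Inductive formula (V : Type) (c : V -> lsort L) : Type :=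
| Bot
| Eqn (s : lsort L) (t u : term c s)
| Rel (r : rsym L) (ts : forall i : 'I_(rarity r), term c (rdom i))
| Imp (phi psi : formula c)
| All (s : lsort L) (phi : formula (ext c s)).

Record structure := Structure {
  dom :> lsort L -> Type;
  fint : forall f : fsym L,
    (forall i : 'I_(farity f), dom (fdom i)) -> dom (fcod f);
  rint : forall r : rsym L,
    (forall i : 'I_(rarity r), dom (rdom i)) -> Prop }.

End Syntax.

Section Semantics.
Variables (L : language) (M : structure L).

Definition assignment (V : Type) (c : V -> lsort L) : Type := forall v, M (c v).

Fixpoint eval (V : Type) (c : V -> lsort L) (e : assignment c) (s : lsort L)
    (t : term c s) : M s :=
  match t with
  | Var v => e v
  | App f ts => fint (fun i => eval e (ts i))
  end.

Definition push (V : Type) (c : V -> lsort L) (e : assignment c) (s : lsort L)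
    (x : M s) : assignment (ext c s) :=
  fun o => if o is Some v as o return M (ext c s o) then e v else x.

Fixpoint sat (V : Type) (c : V -> lsort L) (phi : formula c) :
    assignment c -> Prop :=
  match phi with
  | Bot => fun=> False
  | Eqn s t u => fun e => eval e t = eval e u
  | Rel r ts => fun e => rint (fun i => eval e (ts i))
  | Imp phi psi => fun e => sat phi e -> sat psi e
  | All s phi => fun e => forall x : M s, sat phi (push e x)
  end.

Definition element : Type := {s : lsort L & M s}.

(* Formulas over a set B of parameters are formulas having the elements of B as
   additional variables, which are evaluated to themselves. *)
Definition pctx (V : Type) (c : V -> lsort L) (B : set element)
    (v : V + set_type B) : lsort L :=
  match v with inl v => c v | inr b => tag (val b) end.

Definition penv (V : Type) (c : V -> lsort L) (B : set element)
    (e : assignment c) : assignment (pctx c (B := B)) :=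
  fun v => match v as v return M (pctx c v) with
           | inl v => e v
           | inr b => tagged (val b)
           end.

Definition formula_over (B : set element) (V : Type) (c : V -> lsort L) : Type :=
  formula (pctx c (B := B)).

Definition sat_over (B : set element) (V : Type) (c : V -> lsort L)
    (phi : formula_over B c) (e : assignment c) : Prop :=
  sat phi (penv e).

Record automorphism := Automorphism {
  aut_fun :> forall s, M s -> M s;
  aut_bij : forall s, bijective (@aut_fun s);
  aut_fint : forall (f : fsym L) (a : forall i : 'I_(farity f), M (fdom i)),
    aut_fun (fint a) = fint (fun i => aut_fun (a i));
  aut_rint : forall (r : rsym L) (a : forall i : 'I_(rarity r), M (rdom i)),
    rint (fun i => aut_fun (a i)) <-> rint a }.

Definition act (s : automorphism) (V : Type) (c : V -> lsort L)
    (a : assignment c) : assignment c := fun v => s _ (a v).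

End Semantics.

Arguments assignment {L} M {V} c.
Arguments automorphism {L} M.
Arguments element {L} M.

(** The cardinal kappa is the cardinality of a type K. *)

Definition small (K T : Type) (A : set T) : Prop :=
  (A #<= [set: K]) /\ ~ ([set: K] #<= A).

Definition strong_limit (K : Type) : Prop :=
  small K [set: nat] /\
  forall S : set K, small K S -> small K [set S' : set K | S' `<=` S].

Section Monster.
Variables (L : language) (K : Type) (M : structure L).

(* Every finitely satisfiable partial 1-type over fewer than kappa parameters is
   realized. *)
Definition saturated : Prop :=
  forall (B : set (element M)) (s : lsort L)
         (p : set (formula_over B (fun _ : unit => s))),
    small K B ->
    (forall q : set (formula_over B (fun _ : unit => s)),
       finite_set q -> q `<=` p ->
       exists x : M s, forall phi, q phi -> sat_over phi (fun=> x)) ->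
    exists x : M s, forall phi, p phi -> sat_over phi (fun=> x).

(* g, restricted to B, is a partial elementary map of M. *)
Definition elementary_on (B : set (element M)) (g : forall s, M s -> M s) :
    Prop :=
  forall phi : formula (fun b : set_type B => tag (val b)),
    sat phi (fun b : set_type B => tagged (val b) : M _) <->
    sat phi (fun b : set_type B => g _ (tagged (val b))).

Definition strongly_homogeneous : Prop :=
  forall (B : set (element M)) (g : forall s, M s -> M s),
    small K B -> elementary_on B g ->
    exists s : automorphism M, forall b, B b -> s _ (tagged b) = g _ (tagged b).

Definition type_definable_over (B : set (element M)) (V : Type)
    (c : V -> lsort L) (X : set (assignment M c)) : Prop :=
  exists p : set (formula_over B c),
    X = [set a | forall phi, p phi -> sat_over phi a].

Definition type_definable (V : Type) (c : V -> lsort L)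
    (X : set (assignment M c)) : Prop :=
  exists2 B : set (element M), small K B & type_definable_over B X.

Definition sum_ctx (V : Type) (c : V -> lsort L) (v : V + V) : lsort L :=
  match v with inl v => c v | inr v => c v end.

(* Binary relations are viewed as sets of concatenated tuples. *)
Definition concatenated (V : Type) (c : V -> lsort L)
    (R : set (assignment M c * assignment M c)) :
    set (assignment M (sum_ctx c)) :=
  [set a | R (fun v => a (inl v), fun v => a (inr v))].

(* Tuples of variables may be infinite, but of small length. *)
Record hyperdefinable := Hyperdefinable {
  hvar : Type;
  hsort : hvar -> lsort L;
  hset : set (assignment M hsort);
  hrel : set (assignment M hsort * assignment M hsort);
  hvar_small : small K [set: hvar];
  hset_ne : hset !=set0;
  hset_def : type_definable hset;
  hrel_def : type_definable (concatenated hrel);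
  hrel_sub : hrel `<=` hset `*` hset;
  hrel_refl : forall a, hset a -> hrel (a, a);
  hrel_sym : forall a b, hrel (a, b) -> hrel (b, a);
  hrel_trans : forall a b c, hrel (a, b) -> hrel (b, c) -> hrel (a, c) }.

(* The points of the quotient are the equivalence classes. *)
Definition quotient (P : hyperdefinable) : Type :=
  {x : set (assignment M (@hsort P)) |
     exists2 a, hset a & x = [set b | hrel (a, b)]}.

Definition hyperimaginary : Type := {P : hyperdefinable & quotient P}.

(* s x = y, where s acts on the classes by direct image *)
Definition sends (s : automorphism M) (P : hyperdefinable) (x y : quotient P) :
    Prop :=
  [set act s a | a in sval x] = sval y.

(* s belongs to Aut(M/A). *)
Definition fixes (A : set hyperimaginary) (s : automorphism M) : Prop :=
  forall h, A h -> sends s (projT2 h) (projT2 h).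

(* Besides |A| < kappa, a small set of hyperimaginaries has to satisfy two
   conditions, both vacuous in the standard situation where kappa is regular and
   hyperimaginaries are classes of equivalence relations type-definable over the
   empty set (take D = set0).
   - The representatives of A have total length < kappa.  If kappa is singular,
     |A| < kappa tuples of length < kappa may together list kappa elements.
   - The hyperdefinable sets the elements of A come from may be defined with real
     parameters, but Aut(M/A) has to fix these.  Otherwise, in an infinite set M
     without structure, with B countably infinite, let A consist of the unique
     class M \ B of X = M \ B modulo E = X * X.  Then Aut(M/A) is the stabilizer
     of B, the A-logic topology of M has set0, B and M as only open sets, and no
     uniform structure induces it. *)
Definition small_parameters (A : set hyperimaginary) : Prop :=
  [/\ small K A,
      small K [set: {h : set_type A & hvar (projT1 (val h))}] &
      exists D : set (element M),
        [/\ small K D,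
            forall s : automorphism M, fixes A s ->
              forall d, D d -> s _ (tagged d) = tagged d &
            forall h, A h ->
              type_definable_over D (@hset (projT1 h)) /\
              type_definable_over D (concatenated (@hrel (projT1 h)))]].

Definition invariant (A : set hyperimaginary) (V : Type) (c : V -> lsort L)
    (X : set (assignment M c)) : Prop :=
  forall s : automorphism M, fixes A s -> [set act s a | a in X] = X.

Definition invariant2 (A : set hyperimaginary) (V : Type) (c : V -> lsort L)
    (R : set (assignment M c * assignment M c)) : Prop :=
  forall s : automorphism M, fixes A s ->
    [set (act s ab.1, act s ab.2) | ab in R] = R.

Definition hyperdefinable_over (A : set hyperimaginary) (P : hyperdefinable) :
    Prop :=
  invariant A (@hset P) /\ invariant2 A (@hrel P).

Section LogicTopology.
Variables (A : set hyperimaginary) (P : hyperdefinable).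

Definition preimage1 (D : set (quotient P)) : set (assignment M (@hsort P)) :=
  [set a | exists2 x, D x & sval x a].

Definition preimage2 (D : set (quotient P * quotient P)) :
    set (assignment M (@hsort P) * assignment M (@hsort P)) :=
  [set ab | exists2 xy, D xy & sval xy.1 ab.1 /\ sval xy.2 ab.2].

Definition inf_definable (D : set (quotient P)) : Prop :=
  type_definable (preimage1 D) /\ invariant A (preimage1 D).

Definition inf_definable2 (D : set (quotient P * quotient P)) : Prop :=
  type_definable (concatenated (preimage2 D)) /\ invariant2 A (preimage2 D).

Definition logic_closed (D : set (quotient P)) : Prop := inf_definable D.

Definition logic_open (O : set (quotient P)) : Prop := logic_closed (~` O).

Definition logic_nbhs (x : quotient P) : set_system (quotient P) :=
  [set N | exists O, [/\ logic_open O, O x & O `<=` N]].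

(* interior for the product topology *)
Definition logic_interior2 (D : set (quotient P * quotient P)) :
    set (quotient P * quotient P) :=
  [set xy | filter_prod (logic_nbhs xy.1) (logic_nbhs xy.2) D].

Definition tp (x : quotient P) : set (quotient P) :=
  [set y | exists2 s, fixes A s & sends s x y].

Definition same_tp : set (quotient P * quotient P) :=
  [set xy | tp xy.1 = tp xy.2].

Definition positive_rel (D : set (quotient P * quotient P)) : Prop :=
  inf_definable2 D /\ same_tp `<=` logic_interior2 D.

End LogicTopology.
End Monster.

(** Uniform structures *)

Definition uniform_structure (T : Type) (Phi : set_system (T * T)) : Prop :=
  [/\ Filter Phi,
      forall U, Phi U -> diagonal `<=` U,
      forall U, Phi U -> Phi U^-1 &
      forall U, Phi U -> exists2 V, Phi V & V \; V `<=` U].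

(* The open sets are the sets that are neighbourhoods of all their points, where
   the U(x) = {y | (x, y) in U}, for U in Phi, form a base of neighbourhoods of x. *)
Definition induces (T : Type) (Phi : set_system (T * T))
    (is_open : set_system T) : Prop :=
  forall O : set T, is_open O <-> (forall x, O x -> nbhs_ Phi x O).

Definition uniformity_base (T : Type) (Phi : set_system (T * T))
    (E : set_system (T * T)) : Prop :=
  E `<=` Phi /\ forall U, Phi U -> exists2 V, E V & V `<=` U.

(* Main.v *)
Require Import Defs.
From HB Require Import structures.
From Stdlib Require List.
From mathcomp Require Import all_boot all_classical.
From mathcomp Require Import topology_structure uniform_structure compact product_topology.
Set Implicit Arguments.
Unset Strict Implicit.
Unset Printing Implicit Defensive.
Local Open Scope classical_set_scope.
Local Open Scope card_scope.
Local Open Scope relation_scope.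

(** Conjugacy of representatives under [Aut(M/A)], up to [E], is a type-definable
    equivalence relation [Theta] on [X] (it is a projection of the equality of
    types over a small set of parameters), and the closed subsets of [P] are the
    images of the type-definable [Theta]-invariant subsets of [X].  By saturation
    the logic topology is compact; separating two [Theta]-classes by a definable
    set and taking the [Theta]-saturations of the two halves yields disjoint
    neighbourhoods of points of distinct types.  So [P] is a compact space whose
    quotient by the equality of types is Hausdorff.  Its only uniform structure
    consists of the neighbourhoods of the relation of equality of types, and it
    has a base of closed sets, which are intersections of unions of two
    cylinders over closed sets, hence inf-definable. *)

(** A closed set comes with its own small set of parameters, and arbitrarily many closed sets could
    together need too many. But automorphisms fixing pointwise the chosen representatives of [A] and
    the set [D] of [small_parameters] lie in [Aut(M/A)], so [type_definable_invariant] rewrites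
    every closed set over this one small set. Intersections, compactness and the definability of
    closed relations rest on that. A second obstacle is that [Aut(M/A)] may move representatives
    inside their classes. Conjugacy is therefore a projection along infinitely many coordinates,
    while saturation is assumed for one variable only; types of infinite tuples have to be realized
    first. Since points of equal type are topologically indistinguishable, the uniform theory is
    developed on [P] itself, without forming its Hausdorff quotient. *)

(** * The uniform structure of a compact space *)

(** Common form of the compactness arguments below, all by contradiction: [B V] collects the
    counterexamples at scale [V], and the filter they generate has a cluster point. *)
Lemma compact_accumulation (X : topologicalType) (I : Type)
    (F : set_system I) (B : set I -> set X) :
  compact [set: X] -> Filter F -> {homo B : V W / V `<=` W} ->
  (forall V, F V -> B V !=set0) ->
  exists p : X, forall V N, F V -> nbhs p N -> (B V `&` N) !=set0.
Proof.
move=> Xco FF Bmono Bne.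
have FB : ProperFilter (filter_from F B).
  apply: filter_from_proper; last exact: Bne.
  apply: filter_from_filter; first by exists setT; exact: filterT.
  move=> V W FV FW; exists (V `&` W); first exact: filterI.
  by rewrite subsetI; split; apply: Bmono.
have [|p [_ Fp]] := Xco _ FB; first by exists setT => //; exact: filterT.
by exists p => V N FV Np; apply: Fp => //; exists V.
Qed.

Lemma closed_setX (S T : topologicalType) (C : set S) (D : set T) :
  closed C -> closed D -> closed (C `*` D).
Proof.
move=> clC clD [x y] clxy; split=> /=.
  apply: clC => N xN; have [|[u v] [[/= Cu _] [/= Nu _]]] := clxy (N `*` setT).
    by exists (N, setT) => //; split=> //; exact: filterT.
  by exists u.
apply: clD => N yN; have [|[u v] [[/= _ Dv] [/= _ Nv]]] := clxy (setT `*` N).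
  by exists (setT, N) => //; split=> //; exact: filterT.
by exists v.
Qed.

Definition indistinguishable (T : topologicalType) : set (T * T) :=
  [set xy | nbhs xy.1 = nbhs xy.2].
Arguments indistinguishable : clear implicits.

(** The separation axiom R1: the Kolmogorov quotient is Hausdorff. *)
Definition preregular (T : topologicalType) : Prop :=
  forall x y : T, nbhs x <> nbhs y -> exists2 A, nbhs x A & nbhs y (~` A).

(** Otherwise the closures of neighbourhoods of [x], cut down to the complement of [A], accumulate
    at some [y]. If [y] is indistinguishable from [x], then [A] is a neighbourhood of [y]; if [B]
    separates [x] from [y], then [y] has a neighbourhood missing [closure B]. *)
Lemma preregular_regular (T : topologicalType) (x : T) (A : set T) :
  compact [set: T] -> preregular T -> nbhs x A ->
  exists C, [/\ closed C, nbhs x C & C `<=` A].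
Proof.
move=> Tco Tpre xA; apply: contrapT => noC.
have [||y yP] :=
    @compact_accumulation T T (nbhs x) (fun N => closure N `&` ~` A) Tco _.
- by move=> V W VW; apply: setSI; exact: closure_subset.
- move=> N xN; apply: contrapT => clNA; apply: noC.
  exists (closure N); split; first exact: closed_closure.
    by apply: filterS xN; exact: subset_closure.
  by move=> z clNz; apply: contrapT => Az; apply: clNA; exists z.
have [xy|/Tpre[B xB yB]] := pselect (nbhs x = nbhs y).
  by have [||z [[_ Az] Az']] := yP setT A; [exact: filterT|rewrite -xy|].
have [z [[clBz _] Bz]] := yP B _ xB (nbhs_interior yB).
by have [w [Bw /(_ Bw)]] := clBz _ Bz.
Qed.

Lemma indistinguishable_closed (T : topologicalType) (C : set T) (x y : T) :
  closed C -> nbhs x = nbhs y -> C x -> C y.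
Proof.
by move=> clC xy Cx; apply: clC => N; rewrite -xy => /nbhs_singleton; exists x.
Qed.

Section CompactUniformity.
Variable T : topologicalType.
Hypotheses (Tco : compact [set: T]) (Tpre : preregular T).

Definition indistinguishable_nbhs : set_system (T * T) :=
  [set U | indistinguishable T `<=` interior U].

Let Phi := indistinguishable_nbhs.

Lemma indistinguishable_nbhs_filter : Filter Phi.
Proof.
split=> [|U V PU PV|U V UV PU].
- by move=> x _; exact: filterT.
- by move=> x xT; apply: filterI; [exact: PU|exact: PV].
- by move=> x xT; apply: filterS UV _; exact: PU.
Qed.

(** Closed sets are unions of indistinguishability classes, so the closed box contains no
    indistinguishable pair. These complements are the entourages used in practice. *)
Lemma setCX_indistinguishable_nbhs (C D : set T) :
  closed C -> closed D -> C `&` D = set0 -> Phi (~` (C `*` D)).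
Proof.
move=> clC clD CD [x y]/= xy; apply: open_nbhs_nbhs; split.
  by rewrite openC; exact: closed_setX.
move=> [/= Cx Dy]; have : (C `&` D) y by split=> //; exact: indistinguishable_closed Cx.
by rewrite CD.
Qed.

(* Otherwise the triples [(x, y, z)] with [V (x, y)], [V (y, z)] and [~ U (x, z)]
   accumulate, as [V] shrinks, at a triple of indistinguishable points. *)
Lemma indistinguishable_nbhs_split (U : set (T * T)) :
  Phi U -> exists2 V, Phi V & V \; V `<=` U.
Proof.
move=> PU; apply: contrapT => noV.
pose B (V : set (T * T)) : set (T * T * T) :=
  [set z | [/\ V (z.1.1, z.1.2), V (z.1.2, z.2) & ~ U (z.1.1, z.2)]].
have co3 : compact [set: T * T * T] by rewrite -!setXTT; do 2?apply: compact_setX.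
have [||[[x y] z]/= xyz] :=
    @compact_accumulation _ _ Phi B co3 indistinguishable_nbhs_filter.
- by move=> V W VW [[x y] z] [/= /VW ? /VW].
- move=> V PV; apply: contrapT => BV; apply: noV; exists V => // -[x z] [y Vxy Vyz].
  by apply: contrapT => Uxz; apply: BV; exists (x, y, z).
(* Regularity shrinks the separating neighbourhoods to disjoint closed ones; the entourage avoiding
   their box is incompatible with triples near [(u, v)]. *)
have sep (u v : T) : nbhs u <> nbhs v ->
    exists C D, [/\ nbhs u C, nbhs v D & Phi (~` (C `*` D))].
  move=> /Tpre[N uN vN].
  have [C [clC uC CN]] := preregular_regular Tco Tpre uN.
  have [D [clD vD DN]] := preregular_regular Tco Tpre vN.
  exists C, D; split=> //; apply: setCX_indistinguishable_nbhs => //.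
  by apply/disjoints_subset => w /CN + /DN.
have n3 (N1 N2 N3 : set T) : nbhs x N1 -> nbhs y N2 -> nbhs z N3 ->
    nbhs (x, y, z) (N1 `*` N2 `*` N3).
  move=> n1 n2 ?; exists (N1 `*` N2, N3) => //; split=> //=.
  by exists (N1, N2).
have xy : nbhs x = nbhs y.
  apply: contrapT => /sep[C [D [xC yD PV]]].
  have := xyz _ _ PV (n3 _ _ _ xC yD filterT).
  by case=> -[[u v] w] [[/= +  _ _] [[/= ? ?] _]]; apply.
have yz : nbhs y = nbhs z.
  apply: contrapT => /sep[C [D [xC yD PV]]].
  have := xyz _ _ PV (n3 _ _ _ filterT xC yD).
  by case=> -[[u v] w] [[/= _ + _] [[/= _ ?] ?]]; apply.
(* Now [U] is a neighbourhood of [(x, z)], although the accumulating triples have their outer pair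
   outside [U]. *)
have [[N1 N3] [/= xN1 zN3] NU] : nbhs (x, z) U.
  by apply: PU; rewrite /indistinguishable /= xy.
have := xyz _ _ PU (n3 _ _ _ xN1 filterT zN3).
by case=> -[[u v] w] [[/= _ _ +] [[/= ? _] ?]]; apply; apply: NU.
Qed.

Lemma indistinguishable_nbhs_uniform :
  [/\ Filter Phi, forall U, Phi U -> diagonal `<=` U,
      forall U, Phi U -> Phi U^-1 &
      forall U, Phi U -> exists2 V, Phi V & V \; V `<=` U].
Proof.
split; [exact: indistinguishable_nbhs_filter| | |exact: indistinguishable_nbhs_split].
  by move=> U PU [x y]; rewrite /diagonal/= => <-; apply: nbhs_singleton; exact: PU.
move=> U PU [x y]/= xy; have [[N1 N2] [/= n1 n2] NU] : nbhs (y, x) U by exact: PU.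
by exists (N2, N1) => // -[u v] [/= ? ?]; apply: NU.
Qed.

Lemma indistinguishable_nbhs_nbhs (x : T) : nbhs x = nbhs_ Phi x.
Proof.
apply/seteqP; split=> [A xA|A [U PU UA]].
  have [C [clC xC CA]] := preregular_regular Tco Tpre (nbhs_interior xA).
  (* As [x] lies in [C], every [y] related to [x] by this entourage lies in the interior of [A]. *)
  exists (~` (C `*` ~` interior A)).
    apply: setCX_indistinguishable_nbhs => //.
      by rewrite closedC; exact: open_interior.
    by apply/disjoints_subset => w /CA Aw; apply.
  move=> y /xsectionP xy; apply: contrapT => Ay; apply: xy; split=> /=.
    exact: nbhs_singleton.
  by move=> /nbhs_singleton.
have [|[N1 N2] [/= n1 n2] NU] := PU (x, x); first by [].
apply: filterS n2 => y N2y; apply: UA; apply/xsectionP/NU; split=> //=.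
exact: nbhs_singleton.
Qed.

(** * Uniqueness of the uniform structure, and its closed entourages *)

Section Uniform.
Variable Psi : set_system (T * T).
Hypothesis PsiF : Filter Psi.
Hypothesis Psi_diag : forall U, Psi U -> diagonal `<=` U.
Hypothesis Psi_inv : forall U, Psi U -> Psi U^-1.
Hypothesis Psi_split : forall U, Psi U -> exists2 V, Psi V & V \; V `<=` U.
Hypothesis Psi_nbhs : forall x, nbhs x = nbhs_ Psi x.

Lemma uniform_split3 (U : set (T * T)) : Psi U -> exists V,
  [/\ Psi V, forall x y, V (x, y) -> V (y, x) &
      forall x y z w, V (x, y) -> V (y, z) -> V (z, w) -> U (x, w)].
Proof.
move=> /Psi_split[W /Psi_split[V PV VW] WU].
exists (V `&` V^-1); split=> [|x y [Vxy Vyx]|x y z w [xy _] [yz _] [zw _]].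
- by apply: filterI => //; exact: Psi_inv.
- by split.
(* Two halvings allow four links; the diagonal supplies the fourth. *)
apply: WU; exists z; apply: VW; first by exists y.
by exists w => //; exact: (Psi_diag PV).
Qed.

Lemma uniform_nbhs (U : set (T * T)) (x : T) :
  Psi U -> nbhs x [set y | U (x, y)].
Proof. by move=> PU; rewrite Psi_nbhs; exists U => // y /xsectionP. Qed.

(** An entourage contains a box of smaller balls around each indistinguishable pair. Conversely, if
    [U] in [Phi] were not an entourage, pairs of [V] outside [U] would accumulate at some [(x, y)]
    as [V] shrinks. Indistinguishable [x] and [y] are excluded because [U] is a neighbourhood of
    [(x, y)]; otherwise, chaining [x], [u], [v], [y] through [V] puts [y] into the neighbourhood [A]
    of [x] that should exclude it. *)
Lemma uniform_indistinguishable_nbhs : Psi = Phi.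
Proof.
apply/seteqP; split=> [U /uniform_split3[V [PV Vsym VU]] [x y]/= xy|U PU].
  exists ([set z | V (x, z)], [set z | V (y, z)]); first by split; exact: uniform_nbhs.
  move=> [u v] [/= xu yv]; apply: VU (Vsym _ _ xu) _ yv.
  by have := uniform_nbhs x PV; rewrite xy => /nbhs_singleton.
apply: contrapT => noV.
have co2 : compact [set: T * T] by rewrite -setXTT; apply: compact_setX.
have [||[x y]/= xyP] := @compact_accumulation _ _ Psi (fun V => V `\` U) co2 PsiF.
- by move=> V W VW; apply: setSD.
- move=> V PV; apply: contrapT => VU; apply: noV; apply: filterS PV => xy Vxy.
  by apply: contrapT => Uxy; apply: VU; exists xy.
have [xy|/Tpre[A]] := pselect (nbhs x = nbhs y).
  by have [z [[_ nUz] /nUz]] := xyP _ _ filterT (PU (x, y) xy).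
rewrite Psi_nbhs => -[W PW WA] yA.
have [V [PV Vsym VW]] := uniform_split3 PW.
have [|[u v] [[/= uv _] [/= xu [yv /= Av]]]] := xyP V
  ([set z | V (x, z)] `*` ([set z | V (y, z)] `&` ~` A)) PV.
  exists ([set z | V (x, z)], ([set z | V (y, z)] `&` ~` A)) => //.
  by split; [exact: uniform_nbhs|apply: filterI => //; exact: uniform_nbhs].
apply: (nbhs_singleton yA); apply: WA; apply/xsectionP.
exact: VW xu uv (Vsym _ _ yv).
Qed.

(** The closure of a symmetric [V] lies in its threefold composition. *)
Lemma uniform_closed_base (U : set (T * T)) :
  Psi U -> exists V, [/\ Psi V, closed V & V `<=` U].
Proof.
move=> /uniform_split3[V [PV Vsym VU]]; exists (closure V); split.
- by apply: filterS PV; exact: subset_closure.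
- exact: closed_closure.
move=> [x y] clV; have [|[u v] [uv [/= xu yv]]] :=
    clV ([set z | V (x, z)] `*` [set z | V (y, z)]).
  by exists ([set z | V (x, z)], [set z | V (y, z)]) => //; split; exact: uniform_nbhs.
exact: VU xu uv (Vsym _ _ yv).
Qed.

End Uniform.

Lemma indistinguishable_nbhs_closed_base (U : set (T * T)) :
  Phi U -> exists V, [/\ Phi V, closed V & V `<=` U].
Proof.
case: indistinguishable_nbhs_uniform => ? ? ? ?.
by apply: uniform_closed_base => //; exact: indistinguishable_nbhs_nbhs.
Qed.

End CompactUniformity.

(** [induces] speaks of open sets only. To recover neighbourhoods, the set of points having [A] as a
    [Psi]-neighbourhood is shown to be open, by halving entourages. *)
Lemma induces_nbhs (T : topologicalType) (Psi : set_system (T * T)) :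
  uniform_structure Psi -> induces Psi (@open T) ->
  forall x, nbhs x = nbhs_ Psi x.
Proof.
move=> [PF Pdiag _ Psplit] ind x; apply/seteqP; split=> A.
  rewrite nbhsE => -[U [/ind oU /oU[V PV VU]] UA].
  by exists V => //; exact: subset_trans UA.
move=> xA; rewrite nbhsE; exists [set y | nbhs_ Psi y A]; last first.
  move=> y [U PU UA]; apply: UA; apply/xsectionP; exact: Pdiag PU _ _.
split=> //; apply/ind => y [U PU UA].
have [V PV VU] := Psplit _ PU.
exists V => // z /xsectionP yz; exists V => // w /xsectionP zw.
by apply: UA; apply/xsectionP/VU; exists z.
Qed.

Lemma nbhs_induces (T : topologicalType) (Psi : set_system (T * T)) :
  (forall x, nbhs x = nbhs_ Psi x) -> induces Psi (@open T).
Proof. by move=> nE O; rewrite openE; split=> oO x /oO; rewrite /interior nE. Qed.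

(** * Small cardinals *)

Lemma inj_card_leT (T U : Type) (f : T -> U) :
  injective f -> [set: T] #<= [set: U].
Proof.
move=> f_inj; have /injfunPex[g] : exists2 g : T -> U,
    set_fun setT setT g & set_inj setT g by exists f => // x y _ _; apply: f_inj.
exact: inj_card_le g.
Qed.

(** By Zorn's lemma there is a maximal partial injection; if it missed a point on each side, that
    pair could be adjoined. *)
Lemma card_le_total (T U : Type) (A : set T) (B : set U) : A #<= B \/ B #<= A.
Proof.
pose P (R : set (T * U)) := [/\ R `<=` A `*` B,
  forall x y y', R (x, y) -> R (x, y') -> y = y' &
  forall x x' y, R (x, y) -> R (x', y) -> x = x'].
have [|R [[RAB Rf Ri] Rmax]] := @Zorn_bigcup _ P.
  move=> F FP Ftot; split=> [z [R /FP[RAB _ _] /RAB]//|x y y'|x x' y].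
    move=> [R FR Rxy] [R' FR' Rxy']; have [RR'|R'R] := Ftot _ _ FR FR'.
      by have [_ + _] := FP _ FR'; apply; [exact: RR' Rxy|].
    by have [_ + _] := FP _ FR; apply; [exact: Rxy|exact: R'R].
  move=> [R FR Rxy] [R' FR' Rxy']; have [RR'|R'R] := Ftot _ _ FR FR'.
    by have [_ _] := FP _ FR'; apply; [exact: RR' Rxy|].
  by have [_ _] := FP _ FR; apply; [exact: Rxy|exact: R'R].
have [domR|/existsNP[x /not_implyP[Ax noy]]] :=
    pselect (forall x, A x -> exists y, R (x, y)).
  left; have /choice[f fR] : forall x : set_type A, exists y : set_type B,
      R (val x, val y).
    move=> [x /= /set_mem Ax]; have [y Rxy] := domR _ Ax.
    by have [_ /= By] := RAB _ Rxy; exists (SigSub (mem_set By)).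
  suff /inj_card_leT : injective f by rewrite (card_le_eql (card_setT A)) (card_le_eqr (card_setT B)).
  move=> x x' fxx'; apply: val_inj; apply: (Ri _ _ (val (f x))); first exact: fR.
  by rewrite fxx'; exact: fR.
have [ranR|/existsNP[y /not_implyP[By nox]]] :=
    pselect (forall y, B y -> exists x, R (x, y)).
  right; have /choice[f fR] : forall y : set_type B, exists x : set_type A,
      R (val x, val y).
    move=> [y /= /set_mem By]; have [x1 Rxy] := ranR _ By.
    by have [/= Ax' _] := RAB _ Rxy; exists (SigSub (mem_set Ax')).
  suff /inj_card_leT : injective f by rewrite (card_le_eql (card_setT B)) (card_le_eqr (card_setT A)).
  move=> y' y'' fy; apply: val_inj; apply: (Rf (val (f y'))); first exact: fR.
  by rewrite fy; exact: fR.
exfalso; apply: (Rmax (R `|` [set (x, y)])).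
  by split; [exact: subsetUl|move=> /(_ (x, y) (or_intror erefl)) Rxy; apply: noy; exists y].
split=> [z [/RAB//|-> //]|u v v' [Ruv|[-> ->]] [Ruv'|]|u u' v [Ruv|[-> ->]] [Ruv'|]].
- exact: Rf Ruv Ruv'.
- by case=> ux _; case: noy; exists v; rewrite -ux.
- by case: noy; exists v'.
- by case.
- exact: Ri Ruv Ruv'.
- by case=> _ vy; case: nox; exists u; rewrite -vy.
- by case: nox; exists u'.
- by case.
Qed.

Section Small.
Variable K : Type.

Lemma small_le (T U : Type) (A : set T) (B : set U) :
  A #<= B -> small K B -> small K A.
Proof.
move=> AB [BK KB]; split; first exact: card_le_trans BK.
by move=> KA; apply: KB; exact: card_le_trans AB.
Qed.

Lemma small_image (T U : Type) (f : T -> U) (A : set T) :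
  small K A -> small K (f @` A).
Proof. by apply: small_le; exact: card_image_le. Qed.

Lemma small_set_type (T : Type) (A : set T) :
  small K A -> small K [set: set_type A].
Proof. by apply: small_le; rewrite (card_le_eql (card_setT A)). Qed.

Hypothesis Klim : strong_limit K.

(** [strong_limit] concerns subsets of [K], so [T] is first embedded into [K]. *)
Lemma small_pow (T : Type) : small K [set: T] -> small K [set: set T].
Proof.
move=> Tsmall; have [/card_leP[f] _] := Tsmall.
pose g (x : T) : K := val (f (SigSub (mem_set (I : [set: T] x)))).
have g_inj : injective g.
  by move=> x y /val_inj /(inj (f:=f)) => /(_ (mem_setT _) (mem_setT _)) [].
have := Klim.2 _ (small_image g Tsmall).
apply: small_le; rewrite -(card_le_eqr (card_setT _)).
have gT (A : set T) : [set S | S `<=` range g] (g @` A).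
  by move=> _ [x _ <-]; exists x.
apply: (@inj_card_leT _ _ (fun A => SigSub (mem_set (gT A)))).
move=> A B [] gAB; apply/funext => x.
by rewrite -(image_inj (A := A) g_inj) -(image_inj (A := B) g_inj) gAB.
Qed.

(* The larger of the two types, say [S], absorbs the other one, and [S + S]
   embeds into the double powerset of [S]. *)
Lemma small_sum (S T : Type) :
  small K [set: S] -> small K [set: T] -> small K [set: S + T].
Proof.
wlog ST : S T / [set: T] #<= [set: S] => [th|] Ss Ts.
  have [TS|ST] := card_le_total [set: T] [set: S]; first exact: th.
  apply: small_le (th _ _ ST Ts Ss).
  apply: (@inj_card_leT _ _ (fun x => match x with inl s => inr s | inr t => inl t end)).
  by move=> [x|x] [y|y] //= [->].
apply: small_le (small_pow (small_pow Ss)).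
have [f] := card_leP ST.
pose g (x : T) : S := val (f (SigSub (mem_set (I : [set: T] x)))).
have g_inj : injective g.
  by move=> x y /val_inj /(inj (f:=f)) => /(_ (mem_setT _) (mem_setT _)) [].
(* The extra element [set0] tells the images of [T] from those of [S]. *)
pose h (x : S + T) : set (set S) :=
  match x with inl s => [set [set s]] | inr t => [set [set g t]; set0] end.
apply: (@inj_card_leT _ _ h).
have s11 (s s' : S) : [set s] = [set s'] -> s = s'.
  by move=> e; have : [set s] s by []; rewrite e.
have s10 (s s' : S) : [set [set s]] <> [set [set s']; set0].
  move=> e; have : [set [set s]] (set0 : set S) by rewrite e; right.
  by move=> /= e0; have : [set s] s by []; rewrite -e0.
move=> [x|x] [y|y] /=.
- by move=> e; have : [set [set y]] [set x] by [rewrite -e]; move=> /= /s11 ->.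
- by move=> /s10.
- by move=> /esym/s10.
- move=> e; have [] : [set [set g y]; set0] [set g x] by rewrite -e; left.
    by move=> /s11 /g_inj ->.
  by move=> e0; have : [set g x] (g x) by []; rewrite e0.
Qed.

Lemma small_setU (T : Type) (A B : set T) :
  small K A -> small K B -> small K (A `|` B).
Proof.
move=> As Bs; pose f (x : set_type A + set_type B) : T :=
  match x with inl a => val a | inr b => val b end.
suff -> : A `|` B = range f.
  by apply: small_image; apply: small_sum; exact: small_set_type.
apply/seteqP; split=> [x [Ax|Bx]|_ [[[x Ax]|[x Bx]] _ <-]] /=.
- by exists (inl (SigSub (mem_set Ax))).
- by exists (inr (SigSub (mem_set Bx))).
- by left; exact: set_mem.
- by right; exact: set_mem.
Qed.

End Small.

(** * Definable sets *)

(** [List.In] allows induction on finite sets over a bare type; [Pchoice] supplies the structure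
    needed to obtain the sequence. *)
Lemma finite_set_list (T : Type) (A : set T) :
  finite_set A -> exists l : list T, forall x, A x <-> List.In x l.
Proof.
elim/Pchoice: T => T in A * => /finite_seqP[s ->].
exists s => x /=; elim: s => //= y s IHs; rewrite inE; split.
  by case/orP => [/eqP ->|/IHs]; [left|right].
by case=> [->|/IHs ->]; rewrite ?eqxx ?orbT.
Qed.

Lemma finite_subset_image (S T : Type) (f : S -> T) (A : set S) (B : set T) :
  finite_set B -> B `<=` f @` A ->
  exists A', [/\ finite_set A', A' `<=` A & B = f @` A'].
Proof.
move=> Bfin BfA.
have /choice[g gP] : forall y : set_type B, exists x, A x /\ f x = val y.
  by move=> [y /= /set_mem /BfA[x Ax fx]]; exists x.
exists (range g); split.
- by apply: finite_image; rewrite (eq_finite_set (card_setT B)).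
- by move=> _ [y _ <-]; exact: (gP y).1.
apply/seteqP; split=> [y By|_ [_ [y _ <-] <-]].
  exists (g (SigSub (mem_set By))); first by exists (SigSub (mem_set By)).
  exact: (gP _).2.
by rewrite (gP y).2; exact: set_mem (valP y).
Qed.

Section Substitution.
Variable L : language.

Fixpoint tsubst (V V' : Type) (c : V -> lsort L) (c' : V' -> lsort L)
    (f : forall v, term c' (c v)) (s : lsort L) (t : term c s) : term c' s :=
  match t with
  | Var v => f v
  | App g ts => App (fun i => tsubst f (ts i))
  end.

Definition subst_ext (V V' : Type) (c : V -> lsort L) (c' : V' -> lsort L)
    (f : forall v, term c' (c v)) (s : lsort L) (o : option V) :
    term (ext c' s) (ext c s o) :=
  match o with
  | Some v => tsubst (fun u => @Var _ _ (ext c' s) (Some u)) (f v)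
  | None => @Var _ _ (ext c' s) None
  end.

Fixpoint fsubst (V : Type) (c : V -> lsort L) (phi : formula c) :
    forall (V' : Type) (c' : V' -> lsort L), (forall v, term c' (c v)) ->
      formula c' :=
  match phi with
  | Bot => fun _ _ _ => Bot _
  | Eqn s t u => fun _ _ f => Eqn (tsubst f t) (tsubst f u)
  | Rel r ts => fun _ _ f => Rel (fun i => tsubst f (ts i))
  | Imp phi psi => fun _ _ f => Imp (fsubst phi f) (fsubst psi f)
  | All s phi => fun _ _ f => All (fsubst phi (subst_ext f s))
  end.

Variable M : structure L.

Lemma eval_tsubst (V V' : Type) (c : V -> lsort L) (c' : V' -> lsort L)
    (f : forall v, term c' (c v)) (s : lsort L) (t : term c s)
    (e : assignment M c') :
  eval e (tsubst f t) = eval (fun v => eval e (f v) : M _) t.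
Proof. by elim: t => //= g ts IH; congr fint; apply: functional_extensionality_dep. Qed.

Lemma sat_fsubst (V : Type) (c : V -> lsort L) (phi : formula c) (V' : Type)
    (c' : V' -> lsort L) (f : forall v, term c' (c v)) (e : assignment M c') :
  sat phi (fun v => eval e (f v)) <-> sat (fsubst phi f) e.
Proof.
elim: phi V' c' f e => //= {V c}.
- by move=> V c s t u V' c' f e; rewrite !eval_tsubst.
- move=> V c r ts V' c' f e.
  suff -> : (fun i => eval e (tsubst f (ts i))) =
    (fun i => eval (fun v => eval e (f v) : M _) (ts i)) by [].
  by apply: functional_extensionality_dep => i; rewrite eval_tsubst.
- move=> V c phi IH1 psi IH2 V' c' f e.
  by split=> h /IH1 /h /IH2.
- move=> V c s phi IH V' c' f e.
  have pushE (x : M s) : push (fun v => eval e (f v)) x =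
      (fun o => eval (push e x) (subst_ext f s o)).
    by apply: functional_extensionality_dep => -[v|] //=; rewrite eval_tsubst.
  by split=> h x; have := h x; rewrite pushE => /IH.
Qed.

Lemma term_support (V : Type) (c : V -> lsort L) (s : lsort L) (t : term c s) :
  exists S : set V, finite_set S /\ forall e e' : assignment M c,
    (forall v, S v -> e v = e' v) -> eval e t = eval e' t.
Proof.
elim: t => [v|f ts IH].
  by exists [set v]; split; [exact: finite_set1|move=> e e' /=; apply].
have [S SP] := choice IH; exists (\bigcup_i S i); split.
  by apply: bigcup_finite => [|i _]; [exact: finite_finset|case: (SP i)].
move=> e e' ee' /=; congr fint; apply: functional_extensionality_dep => i.
by apply: (SP i).2 => v Sv; apply: ee'; exists i.
Qed.

(** Contexts may be infinite while a quantifier binds one variable; finite supports are what makes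
    quantifying away infinitely many coordinates first-order. *)
Lemma formula_support (V : Type) (c : V -> lsort L) (phi : formula c) :
  exists S : set V, finite_set S /\ forall e e' : assignment M c,
    (forall v, S v -> e v = e' v) -> sat phi e <-> sat phi e'.
Proof.
elim: phi => {V c}.
- by move=> V c; exists set0; split; first exact: finite_set0.
- move=> V c s t u; have [S [Sfin SP]] := term_support t.
  have [S' [Sfin' SP']] := term_support u.
  exists (S `|` S'); split; first by rewrite finite_setU.
  move=> e e' ee' /=; rewrite (SP e e') 1?(SP' e e') => [//|v Sv|v Sv].
    by apply: ee'; right.
  by apply: ee'; left.
- move=> V c r ts; have [S SP] := choice (fun i => term_support (ts i)).
  exists (\bigcup_i S i); split.
    by apply: bigcup_finite => [|i _]; [exact: finite_finset|case: (SP i)].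
  move=> e e' ee' /=.
  suff -> : (fun i => eval e (ts i)) = (fun i => eval e' (ts i)) by [].
  apply: functional_extensionality_dep => i.
  by apply: (SP i).2 => v Sv; apply: ee'; exists i.
- move=> V c phi [S [Sfin SP]] psi [S' [Sfin' SP']].
  exists (S `|` S'); split; first by rewrite finite_setU.
  move=> e e' ee' /=.
  have -> : sat phi e = sat phi e'.
    by apply/propext/SP => v Sv; apply: ee'; left.
  have -> : sat psi e = sat psi e'.
    by apply/propext/SP' => v Sv; apply: ee'; right.
  by [].
- move=> V c s phi [S [Sfin SP]]; exists (Some @^-1` S); split.
    by apply: finite_preimage => // x y _ _ [].
  move=> e e' ee' /=.
  by split=> h x; have := h x; apply SP => -[v|]//= Sv; rewrite ee'.
Qed.

End Substitution.

Section Definable.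
Variables (L : language) (M : structure L).
Implicit Types B : set (element M).

Definition definable B (V : Type) (c : V -> lsort L)
    (X : set (assignment M c)) : Prop :=
  exists phi : formula_over B c, X = [set a | sat_over phi a].

Definition param B (V : Type) (c : V -> lsort L) (s : lsort L) (x : M s)
    (Bx : B (existT _ s x)) : term (pctx c (B := B)) s :=
  @Var _ _ (pctx c (B := B)) (inr (SigSub (mem_set Bx))).

Section Boolean.
Variables (B : set (element M)) (V : Type) (c : V -> lsort L).
Implicit Types X Y : set (assignment M c).

Lemma definable_setC X : definable B X -> definable B (~` X).
Proof. by move=> [phi ->]; exists (Imp phi (Bot _)). Qed.

Lemma definable_set0 : definable B (set0 : set (assignment M c)).
Proof. by exists (Bot _). Qed.

Lemma definable_setT : definable B (setT : set (assignment M c)).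
Proof. by rewrite -setC0; apply: definable_setC; exact: definable_set0. Qed.

Lemma definable_setU X Y : definable B X -> definable B Y -> definable B (X `|` Y).
Proof.
move=> [phi ->] [psi ->]; exists (Imp (Imp phi (Bot _)) psi).
apply/seteqP; split=> a /=; rewrite /sat_over /=.
  by case=> [? /(_ _)|].
by move=> h; have [|/h] := pselect (sat phi (penv (B := B) a)); [left|right].
Qed.

Lemma definable_setI X Y : definable B X -> definable B Y -> definable B (X `&` Y).
Proof.
move=> /definable_setC X' /definable_setC Y'.
by rewrite -[_ `&` _]setCK setCI; apply: definable_setC; exact: definable_setU.
Qed.

Lemma definable_bigcap (G : set (set (assignment M c))) :
  finite_set G -> G `<=` definable B (c := c) -> definable B (\bigcap_(X in G) X).
Proof.
move=> /finite_set_list[l lG] GB.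
have -> : G = [set X | List.In X l] by apply/seteqP; split=> X /=; rewrite lG.
have {lG GB} : forall X, List.In X l -> definable B X by move=> X /lG /GB.
elim: l => [_|X l IHl lB].
  rewrite [X in definable B X](_ : _ = setT); first exact: definable_setT.
  by apply/seteqP; split=> // a _ X [].
rewrite [X in definable B X](_ : _ = X `&` \bigcap_(X in [set X | List.In X l]) X).
  by apply: definable_setI; [apply: lB; left|apply: IHl => Y lY; apply: lB; right].
apply/seteqP; split=> [a aX|a [Xa aX] Y [<-//|/aX//]].
by split=> [|Y lY]; apply: aX; [left|right].
Qed.

End Boolean.

(** The substituted terms may mention parameters in [B'], so this covers renaming variables,
    freezing coordinates at parameters and enlarging [B]. *)
Lemma definable_subst B B' (V V' : Type) (c : V -> lsort L) (c' : V' -> lsort L)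
    (X : set (assignment M c)) (f : forall v, term (pctx c' (B := B')) (c v)) :
  B `<=` B' -> definable B X ->
  definable B' [set a | X (fun v => eval (penv (B := B') a) (f v))].
Proof.
move=> BB' [phi ->].
pose g (v : V + set_type B) : term (pctx c' (B := B')) (pctx c v) :=
  match v with
  | inl v => f v
  | inr b => @Var _ _ (pctx c' (B := B'))
               (inr (SigSub (mem_set (BB' _ (set_mem (valP b))))))
  end.
exists (fsubst phi g); apply/seteqP; split=> a /=; rewrite /sat_over -sat_fsubst.
  by congr (sat phi _); apply: functional_extensionality_dep => -[].
by congr (sat phi _); apply: functional_extensionality_dep => -[].
Qed.

Definition update (V : Type) (c : V -> lsort L) (a : assignment M c) (v : V)
    (x : M (c v)) : assignment M c :=
  fun u => match pselect (v = u) with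
           | left e => match e in _ = u return M (c u) with erefl => x end
           | right _ => a u
           end.

Lemma update_eq (V : Type) (c : V -> lsort L) (a : assignment M c) (v : V)
    (x : M (c v)) : update a x v = x.
Proof.
by rewrite /update; case: pselect => // e; rewrite (Prop_irrelevance e erefl).
Qed.

Lemma update_neq (V : Type) (c : V -> lsort L) (a : assignment M c) (v : V)
    (x : M (c v)) (u : V) : v <> u -> update a x u = a u.
Proof. by rewrite /update; case: pselect. Qed.

Lemma definable_exists B (V : Type) (c : V -> lsort L) (X : set (assignment M c))
    (v : V) : definable B X -> definable B [set a | exists x, X (update a (v := v) x)].
Proof.
move=> [phi ->].
(* [f] turns [v] into the newly bound variable [None] and shifts the others. *)
pose f (u : V + set_type B) : term (ext (pctx c (B := B)) (c v)) (pctx c u) :=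
  match u with
  | inl u =>
      match pselect (v = u) with
      | left e => match e in _ = u return term _ (c u) with
                  | erefl => @Var _ _ (ext (pctx c (B := B)) (c v)) None
                  end
      | right _ => @Var _ _ (ext (pctx c (B := B)) (c v)) (Some (inl u))
      end
  | inr b => @Var _ _ (ext (pctx c (B := B)) (c v)) (Some (inr b))
  end.
exists (Imp (All (Imp (fsubst phi f) (Bot _))) (Bot _)).
have fE (a : assignment M c) x : penv (update a x) =
    (fun u => eval (push (penv (B := B) a) x) (f u)).
  apply: functional_extensionality_dep => -[u|b] //=; rewrite /update /f.
  by case: pselect => // e; case: u / e.
apply/seteqP; split=> a /=; rewrite /sat_over /=.
  by move=> [x]; rewrite fE => /sat_fsubst h /(_ x).
move=> h; apply: contrapT => nx; apply: h => x hx; apply: nx; exists x.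
by rewrite fE; apply/sat_fsubst.
Qed.

Lemma definable_support B (V : Type) (c : V -> lsort L) (X : set (assignment M c)) :
  definable B X -> exists S : set V, finite_set S /\
    forall a a', (forall v, S v -> a v = a' v) -> X a -> X a'.
Proof.
move=> [phi ->]; have [S [Sfin SP]] := formula_support M phi.
exists (inl @^-1` S); split; first by apply: finite_preimage => // x y _ _ [].
by move=> a a' aa' /=; apply SP => -[v Sv|b//] /=; rewrite aa'.
Qed.

(** All coordinates outside [W] are quantified away, but only those in the finite support matter,
    and these go one at a time. *)
Lemma definable_exists_off B (V : Type) (c : V -> lsort L)
    (X : set (assignment M c)) (W : set V) : definable B X ->
  definable B [set a | exists2 a', forall v, W v -> a' v = a v & X a'].
Proof.
move=> BX; have [S [/finite_set_list[l lS] SP]] := definable_support BX.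
pose Q (l : list V) : set (assignment M c) :=
  [set a | exists2 a', forall v, ~ List.In v l \/ W v -> a' v = a v & X a'].
rewrite [X in definable B X](_ : _ = Q l); last first.
  apply/seteqP; split=> a [a' a'E Xa']; last first.
    by exists a' => // v Wv; apply: a'E; right.
  (* Off the support, the witness can be reset to the values of [a]. *)
  pose b v : M (c v) := if pselect (List.In v l) then a' v else a v.
  exists b => [v|].
    by rewrite /b; case: pselect => // lv []// Wv; exact: a'E.
  by apply: SP Xa' => v /lS lv; rewrite /b; case: pselect.
elim: l {lS} => [|v l IHl].
  rewrite [X in definable B X](_ : _ = X) //.
  apply/seteqP; split=> [a [a' a'E Xa']|a Xa]; last by exists a.
  suff -> : a = a' by [].
  by apply: functional_extensionality_dep => v; rewrite a'E//; left.
have [Wv|nWv] := pselect (W v).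
  rewrite [X in definable B X](_ : _ = Q l) //.
  apply/seteqP; split=> a [a' a'E Xa']; exists a' => // u; last first.
    by move=> uP; apply: a'E; case: uP => uP; [left => lu; apply: uP; right|right].
  move=> uP; apply: a'E.
  have [<-|vu] := pselect (v = u); first by right.
  by case: uP => uP; [left=> -[]|right].
rewrite [X in definable B X](_ : _ = [set a | exists x, Q l (update a (v := v) x)]).
  exact: definable_exists.
apply/seteqP; split=> a.
  move=> [a' a'E Xa']; exists (a' v), a' => // u uP.
  have [vu|vu] := pselect (v = u); first by case: u / vu uP; rewrite update_eq.
  rewrite update_neq//; apply: a'E.
  by case: uP => uP; [left=> -[]|right].
move=> [x [a' a'E Xa']]; exists a' => // u uP.
have vu : v <> u by move=> vu; case: uP; rewrite -vu// => + ; apply; left.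
rewrite a'E ?update_neq//.
by case: uP => uP; [left => lu; apply: uP; right|right].
Qed.

End Definable.

(** * Type-definable sets and saturation *)

Lemma existT_injr (T : Type) (P : T -> Type) (t : T) (x y : P t) :
  existT P t x = existT P t y -> x = y.
Proof. by elim/Peq: T => T in P t x y *; exact: existT_inj2. Qed.

Section TypeDefinable.
Variables (L : language) (M : structure L).
Implicit Types B : set (element M).

Lemma type_definable_overP B (V : Type) (c : V -> lsort L)
    (X : set (assignment M c)) :
  type_definable_over B X <->
  exists2 F : set (set (assignment M c)),
    F `<=` definable B (c := c) & X = \bigcap_(Y in F) Y.
Proof.
split=> [[p ->]|[F FB ->]].
  exists [set [set a | sat_over phi a] | phi in p].
    by move=> _ [phi _ <-]; exists phi.
  apply/seteqP; split=> [a pa _ [phi pphi <-]|a pa phi pphi]; first exact: pa.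
  by apply: (pa [set a | sat_over phi a]); exists phi.
exists [set phi | F [set a | sat_over phi a]].
apply/seteqP; split=> [a Fa phi|a pa Y FY]; first exact: Fa.
by have [phi YE] := FB _ FY; rewrite YE; apply: pa; rewrite /= -YE.
Qed.

Lemma definable_type_definable B (V : Type) (c : V -> lsort L)
    (X : set (assignment M c)) : definable B X -> type_definable_over B X.
Proof.
move=> BX; apply/type_definable_overP; exists [set X]; first by move=> _ ->.
by rewrite bigcap_set1.
Qed.

Lemma type_definable_bigcap B (V : Type) (c : V -> lsort L) (I : Type)
    (D : set I) (X : I -> set (assignment M c)) :
  (forall i, D i -> type_definable_over B (X i)) ->
  type_definable_over B (\bigcap_(i in D) X i).
Proof.
move=> BX; apply/type_definable_overP.
(* Taking all definable supersets avoids choosing a presentation of each [X i]. *)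
exists [set Y | definable B Y /\ exists2 i, D i & X i `<=` Y]; first by move=> Y [].
apply/seteqP; split=> [a Xa Y [_ [i Di XY]]|a Ya i Di]; first exact/XY/Xa.
have /type_definable_overP[F FB XE] := BX i Di.
rewrite XE => Y FY; apply: Ya; split; first exact: FB.
by exists i => //; rewrite XE; exact: bigcap_inf.
Qed.

Lemma type_definable_setI B (V : Type) (c : V -> lsort L)
    (X Y : set (assignment M c)) :
  type_definable_over B X -> type_definable_over B Y ->
  type_definable_over B (X `&` Y).
Proof.
move=> BX BY; rewrite [X in type_definable_over _ X](_ : _ =
    \bigcap_(b in [set: bool]) (if b then X else Y)).
  by apply: type_definable_bigcap => -[].
by apply/seteqP; split=> [a [Xa Ya] []|a XYa]//; split;
  [exact: (XYa true)|exact: (XYa false)].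
Qed.

Lemma type_definable_setU B (V : Type) (c : V -> lsort L)
    (X Y : set (assignment M c)) :
  type_definable_over B X -> type_definable_over B Y ->
  type_definable_over B (X `|` Y).
Proof.
move=> /type_definable_overP[F FB ->] /type_definable_overP[G GB ->].
rewrite [X in type_definable_over _ X](_ : _ =
    \bigcap_(YZ in F `*` G) (YZ.1 `|` YZ.2)).
  apply: type_definable_bigcap => -[Y' Z] [/= /FB BY /GB BZ].
  by apply: definable_type_definable; exact: definable_setU.
apply/seteqP; split=> [a [Fa|Ga] [Y' Z] [/= FY GZ]|a FGa].
- by left; exact: Fa.
- by right; exact: Ga.
have [Fa|/existsNP[Y' /not_implyP[FY nYa]]] := pselect ((\bigcap_(Y in F) Y) a).
  by left.
by right=> Z GZ; case: (FGa (Y', Z)).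
Qed.

Lemma type_definable_subst B B' (V V' : Type) (c : V -> lsort L)
    (c' : V' -> lsort L) (X : set (assignment M c))
    (f : forall v, term (pctx c' (B := B')) (c v)) :
  B `<=` B' -> type_definable_over B X ->
  type_definable_over B' [set a | X (fun v => eval (penv (B := B') a) (f v))].
Proof.
move=> BB' /type_definable_overP[F FB ->].
apply: (@type_definable_bigcap _ _ _ _ _
  (fun Y => [set a | Y (fun v => eval (penv (B := B') a) (f v))])) => Y FY.
by apply: definable_type_definable; apply: definable_subst (FB _ FY).
Qed.

Lemma definable_sub B B' (V : Type) (c : V -> lsort L)
    (X : set (assignment M c)) :
  B `<=` B' -> definable B X -> definable B' X.
Proof.
by move=> BB'; apply: (definable_subst (fun v => @Var _ _ (pctx c (B := B')) (inl v))).
Qed.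

Lemma type_definable_sub B B' (V : Type) (c : V -> lsort L)
    (X : set (assignment M c)) :
  B `<=` B' -> type_definable_over B X -> type_definable_over B' X.
Proof.
by move=> BB'; apply: (type_definable_subst (fun v => @Var _ _ (pctx c (B := B')) (inl v))).
Qed.

Lemma type_definable_reindex B (V V' : Type) (c : V -> lsort L)
    (c' : V' -> lsort L) (X : set (assignment M c))
    (f : forall v, term c' (c v)) :
  type_definable_over B X ->
  type_definable_over B [set a | X (fun v => eval a (f v))].
Proof.
pose g v : term (pctx c' (B := B)) (c v) :=
  tsubst (fun u => @Var _ _ (pctx c' (B := B)) (inl u)) (f v).
move=> /(type_definable_subst g) -/(_ (@subset_refl _ _)).
rewrite (_ : [set a | _] = [set a | X (fun v => eval a (f v))])//.
apply/seteqP; split=> a /=; congr X; apply: functional_extensionality_dep => v;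
  by rewrite eval_tsubst.
Qed.

(** Allows different contexts on the two sides; [join_ctx c c] is convertible to [sum_ctx c], which
    later proofs exploit. *)
Definition join_ctx (V W : Type) (c : V -> lsort L) (d : W -> lsort L)
    (vw : V + W) : lsort L :=
  match vw with inl v => c v | inr w => d w end.

Definition join_asg (V W : Type) (c : V -> lsort L) (d : W -> lsort L)
    (a : assignment M c) (b : assignment M d) : assignment M (join_ctx c d) :=
  fun vw => match vw as vw return M (join_ctx c d vw) with
            | inl v => a v | inr w => b w end.

Definition entries (V : Type) (c : V -> lsort L) (a : assignment M c) :
    set (element M) :=
  range (fun v => existT _ (c v) (a v)).

End TypeDefinable.

(** * Realizing types of infinite tuples *)

Section Saturation.
Variables (L : language) (K : Type) (M : structure L).
Hypotheses (Klim : strong_limit K) (Msat : saturated K M).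
Implicit Types B : set (element M).

Lemma saturated1 B (s : lsort L) (F : set (set (assignment M (fun _ : unit => s)))) :
  small K B -> F `<=` definable B (c := _) ->
  (forall G, finite_set G -> G `<=` F -> \bigcap_(Y in G) Y !=set0) ->
  \bigcap_(Y in F) Y !=set0.
Proof.
move=> Bs FB Ffin.
pose p : set (formula_over B (fun _ : unit => s)) :=
  [set phi | F [set a | sat_over phi a]].
have [q qfin qp|x xp] := @Msat B s p Bs.
  have [|_ [phi qphi <-]|a aP] := Ffin [set [set a | sat_over phi a] | phi in q].
  - exact: finite_image.
  - exact: qp.
  exists (a tt) => phi qphi.
  suff -> : (fun=> a tt) = a by apply: (aP [set a | sat_over phi a]); exists phi.
  by apply: functional_extensionality_dep => -[].
exists (fun=> x) => Y FY; have [phi YE] := FB _ FY.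
by rewrite YE; apply: xp; rewrite /p /= -YE.
Qed.

Lemma small_entries (V : Type) (c : V -> lsort L) (a : assignment M c) :
  small K [set: V] -> small K (entries a).
Proof. exact: small_image. Qed.

(** With the coordinates in [W] frozen at [e] and the rest projected away, the finite parts of [F]
    become a 1-type in coordinate [v] over [B] and the entries of [e]. *)
Lemma saturated_step B (V : Type) (c : V -> lsort L)
    (F : set (set (assignment M c))) (e : assignment M c) (W : set V) (v : V) :
  small K B -> small K [set: V] -> F `<=` definable B (c := c) ->
  (forall G, finite_set G -> G `<=` F -> exists a, 
     (forall u, W u -> a u = e u) /\ forall Y, G Y -> Y a) ->
  ~ W v ->
  exists x : M (c v), forall G, finite_set G -> G `<=` F -> exists a, 
     [/\ forall u, W u -> a u = e u, a v = x & forall Y, G Y -> Y a].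
Proof.
move=> Bs Vs FB Ffin Wv.
pose B' := B `|` entries e.
pose c1 (_ : unit) := c v.
(* Coordinates outside [W] other than [v] also receive values from [e]; [Q] forgets these again. *)
pose f (u : V) : term (pctx c1 (B := B')) (c u) :=
  match pselect (v = u) with
  | left E => match E in _ = u return term _ (c u) with
              | erefl => @Var _ _ (pctx c1 (B := B')) (inl tt)
              end
  | right _ => param c1 (or_intror (ex_intro2 _ _ u I erefl) : B' (existT _ (c u) (e u)))
  end.
pose Q (G : set (set (assignment M c))) : set (assignment M c) :=
  [set a | exists2 a', forall u, (W `|` [set v]) u -> a' u = a u &
     (\bigcap_(Y in G) Y) a'].
pose D G : set (assignment M c1) :=
  [set z | Q G (fun u => eval (penv (B := B') z) (f u))].
have fE (z : assignment M c1) : (fun u => eval (penv (B := B') z) (f u)) =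
    update e (v := v) (z tt).
  apply: functional_extensionality_dep => u; rewrite /f /update.
  by case: pselect => // E; case: u / E.
pose fam := [set G | finite_set G /\ G `<=` F].
have [||H Hfin HD|z zD] := @saturated1 B' (c v) (D @` fam).
- by apply: small_setU => //; exact: small_entries.
- move=> _ [G [Gfin GF] <-]; apply: (@definable_subst _ _ B); first exact: subsetUl.
  apply: definable_exists_off; apply: definable_bigcap => //.
  exact: subset_trans FB.
- have [H' [Hfin' HF ->]] := finite_subset_image Hfin HD.
  (* Finitely many conditions [D G] follow from the single one for the union of the sets [G]. *)
  have [||a [aW aH]] := Ffin (\bigcup_(G in H') G).
  + by apply: bigcup_finite => // G /HF[].
  + by move=> Y [G /HF[_ +] GY]; exact.
  exists (fun=> a v) => _ [G HG <-]; rewrite /D /= fE; exists a.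
    move=> u [Wu|->]; last by rewrite update_eq.
    rewrite update_neq; first exact: aW.
    by move=> vu; apply: Wv; rewrite vu.
  by move=> Y GY; apply: aH; exists G.
exists (z tt) => G Gfin GF.
have : D G z by apply: zD; exists G.
rewrite /D /= fE => -[a aE aG]; exists a; split=> //.
  move=> u Wu; rewrite aE; last by left.
  by rewrite update_neq// => vu; apply: Wv; rewrite vu.
by rewrite aE; [rewrite update_eq|right].
Qed.

(* Zorn's lemma on the partial realizations [S] all of whose requirements remain
   finitely satisfiable; [saturated_step] shows that a maximal one is total.
   Functionality of [S] is the case [G = set0] of [P]. *)
Lemma saturated_many B (V : Type) (c : V -> lsort L)
    (F : set (set (assignment M c))) :
  small K B -> small K [set: V] -> F `<=` definable B (c := c) ->
  (forall G, finite_set G -> G `<=` F -> \bigcap_(Y in G) Y !=set0) ->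
  \bigcap_(Y in F) Y !=set0.
Proof.
move=> Bs Vs FB Ffin.
pose extends (S : set {v & M (c v)}) (a : assignment M c) :=
  forall z, S z -> a (tag z) = tagged z.
pose P (S : set {v & M (c v)}) := forall G, finite_set G -> G `<=` F ->
  exists a, extends S a /\ forall Y, G Y -> Y a.
have [|S [PS Smax]] := @Zorn_bigcup _ P.
  move=> C CP Ctot G Gfin GF.
  have Cfun (z z' : {v & M (c v)}) : (\bigcup_(S in C) S) z ->
      (\bigcup_(S in C) S) z' -> tag z = tag z' -> z = z'.
    move=> [S CS Sz] [S' CS' Sz'].
    have [S2 CS2 [Sz2 Sz2']] : exists2 S2, C S2 & S2 z /\ S2 z'.
      have [SS|SS] := Ctot _ _ CS CS'; first by exists S' => //; split=> //; exact: SS.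
      by exists S => //; split=> //; exact: SS.
    have [a [aS _]] := CP _ CS2 set0 (finite_set0 _) (@sub0set _ _).
    have := aS _ Sz2; have := aS _ Sz2'.
    case: z z' {Sz Sz' Sz2 Sz2'} => [v x] [v' x'] /= ax' ax vv'.
    by case: v' / vv' x' ax' => x' <-; rewrite ax.
  have [C0|/existsNP[S0 /contrapT CS0]] := pselect (forall S, ~ C S).
    have [a aG] := Ffin _ Gfin GF; exists a; split=> //.
    by move=> z [S /C0].
  (* On finitely many coordinates the union of the chain agrees with one of its members. *)
  have Cfin (l : list V) : exists2 S, C S & forall z,
      (\bigcup_(S in C) S) z -> List.In (tag z) l -> S z.
    elim: l => [|v l [S CS Sl]]; first by exists S0.
    have [[z [[S' CS' Sz'] zv]]|nz] :=
        pselect (exists z, (\bigcup_(S in C) S) z /\ tag z = v).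
      have [SS|SS] := Ctot _ _ CS CS'.
        exists S' => // z' Cz' [vz'|lz']; last exact/SS/Sl.
        by rewrite (Cfun z' z)//; [exists S'|rewrite zv].
      exists S => // z' Cz' [vz'|lz']; last exact: Sl.
      by rewrite (Cfun z' z)//; [exact: SS|exists S'|rewrite zv].
    exists S => // z Cz [vz|]; last exact: Sl.
    by case: nz; exists z.
  have /choice[T TP] : forall Y, exists T : set V, G Y -> finite_set T /\
      forall a a', (forall v, T v -> a v = a' v) -> Y a -> Y a'.
    move=> Y; have [GY|nGY] := pselect (G Y); last by exists set0.
    by have [T TP] := definable_support (FB _ (GF _ GY)); exists T.
  have /finite_set_list[l lT] : finite_set (\bigcup_(Y in G) T Y).
    by apply: bigcup_finite => // Y /TP[].
  have [S CS Sl] := Cfin l.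
  have [a [aS aG]] := CP _ CS _ Gfin GF.
  (* Corrects [a] to extend the whole union without changing it on the support of [G]. *)
  have bP v : {x : M (c v) | (v \in \bigcup_(Y in G) T Y -> x = a v) /\
      forall y, (\bigcup_(S in C) S) (existT _ v y) -> x = y}.
    apply: cid; have [[x Cx]|nx] :=
        pselect (exists x, (\bigcup_(S in C) S) (existT _ v x)).
      exists x; split=> [/set_mem/lT lv|y Cy].
        exact/esym/(aS _ (Sl _ Cx lv)).
      exact: existT_injr (Cfun _ _ Cx Cy erefl).
    by exists (a v); split=> // y Cy; case: nx; exists y.
  exists (fun v => sval (bP v)); split.
    by move=> [v x] Cx; apply: (svalP (bP v)).2.
  move=> Y GY; apply: (TP _ GY).2 (aG _ GY) => v TYv.
  by rewrite (svalP (bP v)).1//; apply/mem_set; exists Y.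
have [e [eS _]] := PS set0 (finite_set0 _) (@sub0set _ _).
have Stot v : exists x, S (existT _ v x).
  apply: contrapT => Sv.
  have [G Gfin GF||x xP] := @saturated_step B V c F e
      [set u | exists x, S (existT _ u x)] v Bs Vs FB.
  - have [a [aS aG]] := PS G Gfin GF; exists a; split=> // u [x Sx].
    by have /= -> := aS _ Sx; have /= -> := eS _ Sx.
  - by move=> [x Sx]; apply: Sv; exists x.
  apply: (Smax (S `|` [set existT _ v x])).
    split; first exact: subsetUl.
    by move=> /(_ (existT _ v x) (or_intror erefl)) Sx; apply: Sv; exists x.
  move=> G Gfin GF; have [a [aW av aG]] := xP G Gfin GF.
  exists a; split=> // -[u y] [Sy|]; first by have /= <- := eS _ Sy; apply: aW; exists y.
  by move=> ->.
exists e => Y FY; have [|Z -> //|a [aS aY]] := PS [set Y]; first exact: finite_set1.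
suff -> : e = a by exact: aY.
apply: functional_extensionality_dep => v; have [x Sx] := Stot v.
by have /= -> := aS _ Sx; have /= -> := eS _ Sx.
Qed.

End Saturation.

(** * Automorphisms and homogeneity *)

Section Automorphisms.
Variables (L : language) (M : structure L).
Implicit Types (B : set (element M)) (s : automorphism M).

Lemma eval_act s (V : Type) (c : V -> lsort L) (e : assignment M c)
    (r : lsort L) (t : term c r) : eval (act s e) t = s r (eval e t).
Proof.
elim: t => //= f ts IH; rewrite aut_fint; congr fint.
exact: functional_extensionality_dep.
Qed.

Lemma aut_inj s (r : lsort L) : injective (s r).
Proof. exact: bij_inj (aut_bij s r). Qed.

Lemma sat_act s (V : Type) (c : V -> lsort L) (phi : formula c)
    (e : assignment M c) : sat phi (act s e) <-> sat phi e.
Proof.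
elim: phi e => //= {V c}.
- by move=> V c r t u e; rewrite !eval_act; split=> [/aut_inj|->].
- move=> V c r ts e.
  rewrite (_ : (fun i => eval (act s e) (ts i)) = (fun i => s _ (eval e (ts i)))).
    exact: aut_rint.
  by apply: functional_extensionality_dep => i; rewrite eval_act.
- by move=> V c phi IH1 psi IH2 e; split=> h /IH1 /h /IH2.
- move=> V c r phi IH e.
  have pushE (x : M r) : push (act s e) (s r x) = act s (push e x).
    by apply: functional_extensionality_dep => -[].
  have [g gK Kg] := aut_bij s r.
  split=> h x; first by apply/IH; rewrite -pushE.
  by rewrite -(Kg x) pushE; apply/IH.
Qed.

Lemma act_penv s B (V : Type) (c : V -> lsort L) (a : assignment M c) :
  (forall d, B d -> s _ (tagged d) = tagged d) ->
  penv (B := B) (act s a) = act s (penv (B := B) a).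
Proof.
move=> sB; apply: functional_extensionality_dep => -[//|b] /=.
by rewrite /act /= sB//; exact: set_mem (valP b).
Qed.

Lemma definable_act s B (V : Type) (c : V -> lsort L) (X : set (assignment M c))
    (a : assignment M c) :
  definable B X -> (forall d, B d -> s _ (tagged d) = tagged d) ->
  X (act s a) <-> X a.
Proof. by move=> [phi ->] sB; rewrite /= /sat_over act_penv// sat_act. Qed.

Lemma type_definable_act s B (V : Type) (c : V -> lsort L)
    (X : set (assignment M c)) (a : assignment M c) :
  type_definable_over B X -> (forall d, B d -> s _ (tagged d) = tagged d) ->
  X (act s a) <-> X a.
Proof.
move=> /type_definable_overP[F FB ->] sB; split=> Xa Y FY.
  exact: (definable_act a (FB _ FY) sB).1 (Xa _ FY).
exact: (definable_act a (FB _ FY) sB).2 (Xa _ FY).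
Qed.

Lemma automorphism_inverse s : exists s' : automorphism M,
  (forall r x, s' r (s r x) = x) /\ (forall r x, s r (s' r x) = x).
Proof.
have inv r : {g : M r -> M r | cancel (s r) g /\ cancel g (s r)}.
  by apply: cid; have [g gK Kg] := aut_bij s r; exists g.
pose g r := sval (inv r).
have gK r : cancel (s r) (g r) by have [] := svalP (inv r).
have Kg r : cancel (g r) (s r) by have [] := svalP (inv r).
have gf (f : Defs.fsym L) (a : forall i : 'I_(farity f), M (fdom i)) :
    g _ (fint a) = fint (fun i => g _ (a i)).
  apply: (@aut_inj s); rewrite Kg aut_fint; congr fint.
  by apply: functional_extensionality_dep => i; rewrite Kg.
have gr (r : rsym L) (a : forall i : 'I_(rarity r), M (rdom i)) :
    rint (fun i => g _ (a i)) <-> rint a.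
  have := aut_rint s (fun i => g _ (a i)).
  rewrite (_ : (fun i => s _ (g _ (a i))) = a); first by case; split.
  by apply: functional_extensionality_dep => i; rewrite Kg.
by exists (Automorphism (fun r => Bijective (Kg r) (gK r)) gf gr).
Qed.

Lemma actK s s' : (forall r x, s' r (s r x) = x) ->
  forall (V : Type) (c : V -> lsort L) (a : assignment M c), act s' (act s a) = a.
Proof. by move=> sK V c a; apply: functional_extensionality_dep => v; exact: sK. Qed.

End Automorphisms.

Section Homogeneity.
Variables (L : language) (K : Type) (M : structure L).
Hypotheses (Klim : strong_limit K) (Msat : saturated K M)
  (Mhom : strongly_homogeneous K M).
Implicit Types B : set (element M).

(** Homogeneity is about maps on sets of elements, whereas a tuple may repeat entries; the equations
    in its type make the map [g] from [a] to [b] well defined. *)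
Lemma equal_type_automorphism (V : Type) (c : V -> lsort L)
    (a b : assignment M c) :
  small K [set: V] -> (forall phi, sat phi a <-> sat phi b) ->
  exists s : automorphism M, act s a = b.
Proof.
move=> Vs ab.
(* [g] is defined on the values at [a] of all terms, not only of variables, so
   that no transport between equal sorts is needed. *)
pose g (r : lsort L) (x : M r) : M r :=
  match pselect (exists t : term c r, eval a t = x) with
  | left h => eval b (sval (cid h))
  | right _ => x
  end.
have gE r (t : term c r) : g r (eval a t) = eval b t.
  rewrite /g; case: pselect => [h|[]]; last by exists t.
  by case: cid => u /= ut; apply/(ab (Eqn u t)).
have [||s sP] := @Mhom (entries a) g; first exact: small_entries.
  move=> phi.
  have tP (z : set_type (entries a)) : {t : term c (tag (val z)) |
      eval a t = tagged (val z)}.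
    apply: cid; case: z => z /= /set_mem[v _ <-].
    by exists (@Var _ _ c v).
  pose t z := sval (tP z).
  have -> : (fun z : set_type (entries a) => tagged (val z) : M _) =
      (fun z => eval a (t z)).
    by apply: functional_extensionality_dep => z; rewrite (svalP (tP z)).
  rewrite (sat_fsubst phi t a) ab -(sat_fsubst phi t b).
  rewrite (_ : (fun z => eval b (t z)) =
    (fun z : set_type (entries a) => g _ (tagged (val z))))//.
  by apply: functional_extensionality_dep => z; rewrite -(svalP (tP z)) gE.
exists s; apply: functional_extensionality_dep => v.
have /sP /= : entries a (existT _ (c v) (a v)) by exists v.
by rewrite /act => ->; rewrite (gE _ (@Var _ _ c v)).
Qed.

(** The parameters become further coordinates of the tuples. One implication is enough, since
    definable sets are closed under complement. *)
Lemma equal_type_automorphism_over B (V : Type) (c : V -> lsort L)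
    (a b : assignment M c) :
  small K B -> small K [set: V] ->
  (forall Y, definable B Y -> Y a -> Y b) ->
  exists2 s : automorphism M,
    (forall d, B d -> s _ (tagged d) = tagged d) & act s a = b.
Proof.
move=> Bs Vs ab.
have [||s sab] := @equal_type_automorphism _ _ (penv (B := B) a) (penv (B := B) b).
- by apply: small_sum => //; exact: small_set_type.
- move=> phi; split=> [pa|pb]; first by apply: (ab [set e | sat_over phi e]) => //; exists phi.
  apply: contrapT => npa.
  apply: (ab (~` [set e | sat_over phi e])) => //.
  by apply: definable_setC; exists phi.
exists s.
  move=> d Bd; have := congr1 (fun e => e (inr (SigSub (mem_set Bd)))) sab.
  by [].
apply: functional_extensionality_dep => v.
by have := congr1 (fun e => e (inl v)) sab.
Qed.

Lemma type_definable_compact B (V : Type) (c : V -> lsort L)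
    (F : set (set (assignment M c))) :
  small K B -> small K [set: V] -> F `<=` type_definable_over B (c := c) ->
  (forall G, finite_set G -> G `<=` F -> \bigcap_(Y in G) Y !=set0) ->
  \bigcap_(Y in F) Y !=set0.
Proof.
move=> Bs Vs FB Ffin.
pose F' := [set Y | definable B (c := c) Y /\ exists2 X, F X & X `<=` Y].
have [Y []//|G Gfin GF|a aF] := saturated_many Klim Msat Bs Vs (F := F').
  have /choice[h hP] : forall Y, exists X, G Y -> F X /\ X `<=` Y.
    move=> Y; have [/GF[_ [X FX XY]]|nGY] := pselect (G Y); last by exists set0.
    by exists X.
  have [||a ha] := Ffin (h @` G); first exact: finite_image.
    by move=> _ [Y /hP[FhY _] <-].
  by exists a => Y GY; apply: (hP _ GY).2; apply: ha; exists Y.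
exists a => X FX; have /type_definable_overP[H HB XE] := FB _ FX.
rewrite XE => Y HY; apply: aF; split; first exact: HB.
by exists X => //; rewrite XE; exact: bigcap_inf.
Qed.

(** By saturation the projection is the intersection of the projections of the finite
    subintersections, and these are definable. *)
Lemma type_definable_proj (V W : Type) (c : V -> lsort L) (d : W -> lsort L)
    (X : set (assignment M (join_ctx c d))) :
  small K [set: V] -> small K [set: W] -> type_definable K X ->
  type_definable K [set a | exists b, X (join_asg a b)].
Proof.
move=> Vs Ws [B Bs /type_definable_overP[F FB ->]].
(* If some sort in [d] is empty, there is no second half and the projection is empty. *)
have [b0|nb] := pselect (inhabited (assignment M d)); last first.
  exists B => //; rewrite [X in type_definable_over _ X](_ : _ = set0).
    by apply: definable_type_definable; exact: definable_set0.
  by apply/seteqP; split=> // a [b]; case: nb.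
case: b0 => b0.
(* [b0] is an arbitrary filler for the second half, which [Q] forgets; as parameters, its entries
   leave only the variables of [c]. *)
pose B' := B `|` entries b0; exists B'.
  by apply: small_setU => //; exact: small_entries.
pose f (u : V + W) : term (pctx c (B := B')) (join_ctx c d u) :=
  match u with
  | inl v => @Var _ _ (pctx c (B := B')) (inl v)
  | inr w => param c (or_intror (ex_intro2 _ _ w I erefl) :
                        B' (existT _ (d w) (b0 w)))
  end.
pose Q (G : set (set (assignment M (join_ctx c d)))) : set (assignment M (join_ctx c d)) :=
  [set z | exists2 z', forall u, range inl u -> z' u = z u & (\bigcap_(Y in G) Y) z'].
have fE (a : assignment M c) :
    (fun u => eval (penv (B := B') a) (f u)) = join_asg a b0.
  by apply: functional_extensionality_dep => -[].
rewrite [X in type_definable_over _ X](_ : _ =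
    \bigcap_(G in [set G | finite_set G /\ G `<=` F]) [set a | Q G (join_asg a b0)]).
  apply: type_definable_bigcap => G [Gfin GF]; apply: definable_type_definable.
  have : definable B' [set a | Q G (fun u => eval (penv (B := B') a) (f u))].
    apply: (@definable_subst _ _ B); first exact: subsetUl.
    apply: definable_exists_off; apply: definable_bigcap => //.
    exact: subset_trans FB.
  by congr definable; apply/seteqP; split=> a /=; rewrite fE.
apply/seteqP; split=> [a [b Xab] G [Gfin GF]|a aQ].
  by exists (join_asg a b); [move=> _ [v _ <-]|move=> Y GY; apply: Xab; exact: GF].
(* Conversely, the entries of [a] become parameters and the fibre above [a] is a finitely
   satisfiable type. *)
pose B2 := B `|` entries a.
pose f2 (u : V + W) : term (pctx d (B := B2)) (join_ctx c d u) :=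
  match u with
  | inr w => @Var _ _ (pctx d (B := B2)) (inl w)
  | inl v => param d (or_intror (ex_intro2 _ _ v I erefl) :
                        B2 (existT _ (c v) (a v)))
  end.
have f2E (b : assignment M d) :
    (fun u => eval (penv (B := B2) b) (f2 u)) = join_asg a b.
  by apply: functional_extensionality_dep => -[].
have [|||b bF] := @saturated_many L K M Klim Msat B2 W d
    [set [set b | Y (join_asg a b)] | Y in F] _ Ws.
- by apply: small_setU => //; exact: small_entries.
- move=> _ [Y /FB BY <-].
  have := @definable_subst _ _ B B2 _ _ _ _ _ f2 (@subsetUl _ _ _) BY.
  by congr definable; apply/seteqP; split=> b /=; rewrite f2E.
- move=> H Hfin HF; have [G [Gfin GF ->]] := finite_subset_image Hfin HF.
  have [z' z'a Gz'] := aQ G (conj Gfin GF).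
  exists (fun w => z' (inr w)) => _ [Y GY <-] /=.
  rewrite (_ : join_asg _ _ = z'); first exact: Gz'.
  apply: functional_extensionality_dep => -[v|//] /=.
  by rewrite z'a//; exists v.
by exists b => Y FY; apply: (bF [set b | Y (join_asg a b)]); exists Y.
Qed.

(* A point of the intersection of the [B]-definable supersets of [X] has, by
   compactness, the same type over [B] as a point of [X]. *)
Lemma type_definable_invariant B (V : Type) (c : V -> lsort L)
    (X : set (assignment M c)) :
  small K B -> small K [set: V] -> type_definable K X ->
  (forall s : automorphism M, (forall d, B d -> s _ (tagged d) = tagged d) ->
     forall a, X a -> X (act s a)) ->
  type_definable_over B X.
Proof.
move=> Bs Vs [B1 B1s B1X] Xinv; apply/type_definable_overP.
exists [set Y | definable B Y /\ X `<=` Y]; first by move=> Y [].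
apply/seteqP; split=> [a Xa Y [_]|a Xa]; first exact.
(* A point satisfying [F] lies in [X] and has the type of [a] over [B]. *)
pose F := [set X] `|` [set Y | definable B Y /\ Y a].
have [|Y|G Gfin GF|b bF] := @type_definable_compact (B1 `|` B) _ _ F _ Vs.
- exact: small_setU.
- case=> [->|[BY _]]; first by apply: type_definable_sub B1X; exact: subsetUl.
  by apply: definable_type_definable; apply: definable_sub BY; exact: subsetUr.
- pose Z := \bigcap_(Y in G `&` [set Y | definable B Y /\ Y a]) Y.
  (* If [Z] missed [X], its complement would be a [B]-definable superset of [X] and so contain
     [a]. *)
  have BZ : definable B Z.
    by apply: definable_bigcap => [|Y [_ []]//]; exact: finite_setIl.
  have Za : Z a by move=> Y [_ []].
  apply: contrapT => GX; suff : (~` Z) a by apply.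
  apply: Xa; split; first exact: definable_setC.
  move=> b Xb Zb; apply: GX; exists b => Y GY.
  by case: (GF _ GY) => [->//|BYa]; apply: Zb.
have [Y BY Yb|s sB <-] := @equal_type_automorphism_over B _ _ b a Bs Vs.
  apply: contrapT => nYa; have /bF : F (~` Y).
    by right; split=> //; exact: definable_setC.
  exact.
by apply: Xinv => //; apply: bF; left.
Qed.

End Homogeneity.

(** * Hyperdefinable sets *)

Section Separation.
Variables (L : language) (K : Type) (M : structure L).
Hypotheses (Klim : strong_limit K) (Msat : saturated K M).

(** By compactness finitely many of the sets cutting out [Y] and [Z] already have empty
    intersection; those belonging to [Y] give [X]. *)
Lemma type_definable_separation (B : set (element M)) (V : Type)
    (c : V -> lsort L) (Y Z : set (assignment M c)) :
  small K B -> small K [set: V] ->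
  type_definable_over B Y -> type_definable_over B Z -> Y `&` Z = set0 ->
  exists X, [/\ definable B X, Y `<=` X & Z `<=` ~` X].
Proof.
move=> Bs Vs /type_definable_overP[F FB YE] /type_definable_overP[G GB ZE] YZ.
apply: contrapT => noX.
have [U [/FB//|/GB//]|H Hfin HFG|a aFG] :=
    @saturated_many L K M Klim Msat B V c (F `|` G) Bs Vs.
  apply: contrapT => Hempty; apply: noX.
  exists (\bigcap_(U in H `&` F) U); split.
  - by apply: definable_bigcap => [|U [_ /FB]//]; exact: finite_setIl.
  - by rewrite YE => a Fa U [_ FU]; exact: Fa.
  - rewrite ZE => a Ga HFa; apply: Hempty; exists a => U HU.
    by case: (HFG _ HU) => [FU|/Ga//]; apply: HFa.
suff : (Y `&` Z) a by rewrite YZ.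
by rewrite YE ZE; split=> U UFG; apply: aFG; [left|right].
Qed.

End Separation.

Section Hyperdefinable.
Variables (L : language) (K : Type) (M : structure L).

Section Quotient.
Variable P : hyperdefinable K M.

HB.instance Definition _ := gen_eqMixin (quotient P).
HB.instance Definition _ := gen_choiceMixin (quotient P).

Definition rep (x : quotient P) : assignment M (@hsort L K M P) :=
  sval (cid2 (svalP x)).

Lemma rep_hset (x : quotient P) : hset (rep x).
Proof. by rewrite /rep; case: cid2. Qed.

Lemma quotientE (x : quotient P) : sval x = [set b | hrel (rep x, b)].
Proof. by rewrite /rep; case: cid2. Qed.

Lemma mem_rep (x : quotient P) : sval x (rep x).
Proof. by rewrite quotientE; apply: hrel_refl; exact: rep_hset. Qed.

Lemma quotient_hset (x : quotient P) a : sval x a -> hset a.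
Proof. by rewrite quotientE => /hrel_sub[]. Qed.

Lemma quotient_hrel (x : quotient P) a b : sval x a -> (sval x b <-> hrel (a, b)).
Proof.
rewrite quotientE => xa; split=> xb; last exact: hrel_trans xb.
by apply: hrel_trans xb; exact: hrel_sym.
Qed.

Lemma quotient_inj (x y : quotient P) a : sval x a -> sval y a -> x = y.
Proof.
move=> xa ya; case: x y xa ya => [X Xq] [Y Yq] /= xa ya; apply: eq_exist.
apply/seteqP; split=> b.
  move=> /(@quotient_hrel (exist _ X Xq) _ _ xa) ab.
  exact/(@quotient_hrel (exist _ Y Yq) _ _ ya).
move=> /(@quotient_hrel (exist _ Y Yq) _ _ ya) ab.
exact/(@quotient_hrel (exist _ X Xq) _ _ xa).
Qed.

Lemma quotient_class a : hset a -> exists x : quotient P, sval x a.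
Proof.
move=> Xa.
pose Q (x : set (assignment M (@hsort L K M P))) :=
  exists2 a', hset a' & x = [set b | hrel (a', b)].
by exists (exist Q _ (ex_intro2 _ _ a Xa erefl)); exact: hrel_refl.
Qed.

End Quotient.

(** * The group [Aut(M/A)] and its orbits *)

Section FixingAutomorphisms.
Variable A : set (hyperimaginary K M).

Lemma sends_inverse (s s' : automorphism M) (P : hyperdefinable K M)
    (x y : quotient P) :
  (forall r a, s' r (s r a) = a) -> sends s x y -> sends s' y x.
Proof.
move=> sK; rewrite /sends => <-; apply/seteqP; split=> [_ [_ [a xa <-] <-]|a xa].
  by rewrite actK.
by exists (act s a); [exists a|rewrite actK].
Qed.

Lemma fixes_inverse (s s' : automorphism M) :
  (forall r a, s' r (s r a) = a) -> fixes A s -> fixes A s'.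
Proof. by move=> sK sA h /sA; exact: sends_inverse. Qed.

Definition id_automorphism : automorphism M.
Proof.
exists (fun _ a => a) => //.
by move=> r; exists id.
Defined.

Definition comp_automorphism (s t : automorphism M) : automorphism M.
Proof.
exists (fun r a => s r (t r a)) => [r|f a|r a].
- by apply: bij_comp; exact: aut_bij.
- by rewrite !aut_fint.
- by rewrite !aut_rint.
Defined.

Lemma sends_comp (s t : automorphism M) (P : hyperdefinable K M)
    (x y z : quotient P) :
  sends t x y -> sends s y z -> sends (comp_automorphism s t) x z.
Proof. by rewrite /sends => <- <-; rewrite image_comp. Qed.

Lemma tpP (P : hyperdefinable K M) (x y : quotient P) :
  tp A x = tp A y <-> exists2 s, fixes A s & sends s x y.
Proof.
split=> [xy|[s sA sxy]].
  suff : tp A x y by [].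
  by rewrite xy; exists id_automorphism; rewrite /fixes /sends => *; rewrite image_id.
have [s' [sK Ks]] := automorphism_inverse s.
apply/seteqP; split=> z [t tA txz].
  exists (comp_automorphism t s'); last exact: sends_comp (sends_inverse sK sxy) txz.
  by move=> h Ah; apply: sends_comp (fixes_inverse sK sA Ah) (tA _ Ah).
exists (comp_automorphism t s); last exact: sends_comp sxy txz.
by move=> h Ah; apply: sends_comp (sA _ Ah) (tA _ Ah).
Qed.

(** [Aut(M/A)] is closed under inverses, so one inclusion gives equality. *)
Lemma invariantP (V : Type) (c : V -> lsort L) (X : set (assignment M c)) :
  Defs.invariant A X <-> forall s, fixes A s -> forall a, X a -> X (act s a).
Proof.
split=> [Xinv s sA a Xa|Xinv s sA]; first by rewrite -(Xinv s sA); exists a.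
have [s' [sK Ks]] := automorphism_inverse s.
apply/seteqP; split=> [_ [a Xa <-]|a Xa]; first exact: Xinv.
exists (act s' a); last exact: actK.
by apply: Xinv => //; exact: fixes_inverse sA.
Qed.

Lemma invariant2P (V : Type) (c : V -> lsort L)
    (R : set (assignment M c * assignment M c)) :
  invariant2 A R <->
  forall s, fixes A s -> forall a b, R (a, b) -> R (act s a, act s b).
Proof.
split=> [Rinv s sA a b Rab|Rinv s sA]; first by rewrite -(Rinv s sA); exists (a, b).
have [s' [sK Ks]] := automorphism_inverse s.
apply/seteqP; split=> [_ [[a b] Rab <-]|[a b] Rab]; first exact: Rinv.
exists (act s' a, act s' b); last by rewrite /= !(actK Ks).
by apply: Rinv => //; exact: fixes_inverse sA.
Qed.

End FixingAutomorphisms.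

(** * Conjugacy over [A] and the logic topology *)

Section LogicSpace.
Hypotheses (Klim : strong_limit K) (Msat : saturated K M)
  (Mhom : strongly_homogeneous K M).
Variable A : set (hyperimaginary K M).
Hypothesis A_small : small_parameters A.

Definition rep_ctx (hv : {h : set_type A & hvar (projT1 (val h))}) : lsort L :=
  hsort (projT2 hv).

(** All representatives of [A] form a single tuple, whose length [small_parameters] bounds. *)
Definition reps : assignment M rep_ctx :=
  fun hv => rep (projT2 (val (projT1 hv))) (projT2 hv).

(** Fixing [D], [s] preserves the relations and hence permutes their classes; one point of a class
    then decides whether it is fixed. *)
Lemma fixes_sufficient (D : set (element M)) (s : automorphism M) :
  (forall h, A h -> type_definable_over D (concatenated (@hrel _ _ _ (projT1 h)))) ->
  (forall d, D d -> s _ (tagged d) = tagged d) ->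
  (forall h, A h -> hrel (rep (projT2 h), act s (rep (projT2 h)))) ->
  fixes A s.
Proof.
move=> Ddef sD sA h Ah; rewrite /sends.
have [s' [sK Ks]] := automorphism_inverse s.
have hrel_act a b : hrel (act s a, act s b) <-> @hrel _ _ _ (projT1 h) (a, b).
  have := type_definable_act (join_asg a b : assignment M (sum_ctx _)) (Ddef _ Ah) sD.
  by [].
apply/seteqP; split=> [_ [b xb <-]|b xb].
  apply/(quotient_hrel _ (mem_rep _)); apply: hrel_trans (sA _ Ah) _.
  by apply/hrel_act/(quotient_hrel _ (mem_rep _)).
exists (act s' b); last exact: actK.
apply/(quotient_hrel _ (mem_rep _))/hrel_act; rewrite (actK Ks).
apply: hrel_trans (hrel_sym (sA _ Ah)) _.
exact/(quotient_hrel _ (mem_rep _)).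
Qed.

(** [D] is kept apart from [entries reps]: elements of [Aut(M/A)] fix [D] pointwise but may move
    representatives. *)
Lemma fixing_parameters : exists D : set (element M),
  [/\ small K D,
      forall s : automorphism M, fixes A s -> forall d, D d -> s _ (tagged d) = tagged d,
      forall h, A h -> type_definable_over D (concatenated (@hrel _ _ _ (projT1 h))) &
      forall s : automorphism M,
        (forall d, (D `|` entries reps) d -> s _ (tagged d) = tagged d) -> fixes A s].
Proof.
have [_ _ [D [Ds Dfix Ddef]]] := A_small; exists D; split=> //.
  by move=> h /Ddef[].
move=> s sB; apply: (@fixes_sufficient D) => [h /Ddef[]//|d Dd|h Ah].
  by apply: sB; left.
suff -> : act s (rep (projT2 h)) = rep (projT2 h) by apply: hrel_refl; exact: rep_hset.
apply: functional_extensionality_dep => v.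
pose hv : {h : set_type A & hvar (projT1 (val h))} := existT _ (SigSub (mem_set Ah)) v.
by apply: (sB (existT _ _ (reps hv))); right; exists hv.
Qed.

Lemma small_parameter_set (D : set (element M)) :
  small K D -> small K (D `|` entries reps).
Proof.
by move=> Ds; apply: small_setU => //; apply: small_entries; case: A_small.
Qed.

Variable P : hyperdefinable K M.
Hypothesis PA : hyperdefinable_over A P.

Local Notation X := (@hset L K M P).
Local Notation c := (@hsort L K M P).
Local Notation E := (@hrel L K M P).

Lemma hset_act (s : automorphism M) a : fixes A s -> X a -> X (act s a).
Proof. by move=> sA; have /invariantP := PA.1; apply. Qed.

Lemma hrel_act (s : automorphism M) a b :
  fixes A s -> E (a, b) -> E (act s a, act s b).
Proof. by move=> sA; have /invariant2P := PA.2; apply. Qed.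

Let Vs : small K [set: hvar P] := @hvar_small _ _ _ P.

Definition conj_rel : set (assignment M c * assignment M c) :=
  [set ab | X ab.1 /\ exists2 s, fixes A s & E (act s ab.1, ab.2)].

Local Notation Theta := conj_rel.

Lemma sendsP (s : automorphism M) (x y : quotient P) a b :
  fixes A s -> sval x a -> sval y b -> (sends s x y <-> E (act s a, b)).
Proof.
move=> sA xa yb; split=> [sxy|sab].
  by apply: hrel_sym; apply/(quotient_hrel _ yb); rewrite -sxy; exists a.
have [s' [sK Ks]] := automorphism_inverse s.
have s'A := fixes_inverse sK sA.
rewrite /sends; apply/seteqP; split=> [_ [a' xa' <-]|b' yb'].
  apply/(quotient_hrel _ yb); apply: hrel_trans (hrel_sym sab) _.
  by apply: hrel_act => //; exact/(quotient_hrel _ xa).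
exists (act s' b'); last exact: actK.
apply/(quotient_hrel _ xa); rewrite -(actK sK a); apply: hrel_act => //.
by apply: hrel_trans sab _; exact/(quotient_hrel _ yb).
Qed.

Lemma same_tpP (x y : quotient P) a b : sval x a -> sval y b ->
  (same_tp A (x, y) <-> Theta (a, b)).
Proof.
move=> xa yb; split.
  move=> /tpP[s sA sxy]; split; first exact: quotient_hset xa.
  by exists s => //; apply/(sendsP sA xa yb).
by move=> [_ [s sA sab]]; apply/tpP; exists s => //; apply/(sendsP sA xa yb).
Qed.

Lemma conj_rel_refl a : X a -> Theta (a, a).
Proof. by move=> /quotient_class[x xa]; apply/(same_tpP xa xa). Qed.

Lemma conj_rel_hset a b : Theta (a, b) -> X a /\ X b.
Proof. by move=> [Xa [s _ /hrel_sub[]]]. Qed.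

Lemma conj_rel_sym a b : Theta (a, b) -> Theta (b, a).
Proof.
move=> ab; have [/quotient_class[x xa] /quotient_class[y yb]] := conj_rel_hset ab.
by apply/(same_tpP yb xa); have /(same_tpP xa yb) := ab; move=> /esym.
Qed.

Lemma conj_rel_trans b a d : Theta (a, b) -> Theta (b, d) -> Theta (a, d).
Proof.
move=> ab bd; have [/quotient_class[x xa] /quotient_class[y yb]] := conj_rel_hset ab.
have [_ /quotient_class[z zd]] := conj_rel_hset bd.
apply/(same_tpP xa zd); move: ab bd => /(same_tpP xa yb) + /(same_tpP yb zd).
exact: etrans.
Qed.

Lemma conj_rel_act (s : automorphism M) a : fixes A s -> X a -> Theta (a, act s a).
Proof.
by move=> sA Xa; split=> //; exists s => //; apply: hrel_refl; exact: hset_act.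
Qed.

(* With [D] the parameters fixed by [Aut(M/A)] and [a*] the tuple of
   representatives of [A], [b] and [b'] are conjugate up to [E] iff there are
   [a'] and [b''] with [a*, b] and [a', b''] of the same type over [D], each
   entry of [a'] equivalent to that of [a*], and [b'' E b']. *)
Lemma type_definable_conj_rel : type_definable K (concatenated Theta).
Proof.
have [D [Ds Dfix Ddef Dsuff]] := fixing_parameters.
have [BE BEs BEE] := @hrel_def _ _ _ P.
pose B := (D `|` entries reps) `|` BE.
have Bs : small K B by apply: small_setU => //; exact: small_parameter_set.
have DB : D `<=` B by move=> d Dd; left; left.
pose cw := join_ctx rep_ctx c.
(* An assignment here lists [(b, b')] and then [(a', b'')]; [T1] relates [a'] to [a*], [T2] relates
   [b''] to [b'], and [T3] expresses equality of types over [D]. *)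
pose cz := join_ctx (sum_ctx c) cw.
pose var u : term (pctx cz (B := B)) (cz u) := @Var _ _ (pctx cz (B := B)) (inl u).
pose T1 : set (assignment M cz) := \bigcap_(h in [set: set_type A])
  [set z | @hrel _ _ _ (projT1 (val h)) (rep (projT2 (val h)),
     fun v => z (inr (inl (existT _ h v))))].
pose T2 : set (assignment M cz) :=
  [set z | E (fun v => z (inr (inr v)), fun v => z (inl (inr v)))].
pose T3 : set (assignment M cz) := \bigcap_(Y in definable D (c := cw))
  (~` [set z | Y (join_asg reps (fun v => z (inl (inl v))))] `|`
   [set z | Y (fun u => z (inr u))]).
have T1B : type_definable_over B T1.
  apply: type_definable_bigcap => h _.
  pose f (u : hvar (projT1 (val h)) + hvar (projT1 (val h))) :
      term (pctx cz (B := B)) (sum_ctx (@hsort _ _ _ _) u) :=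
    match u with
    | inl v => param cz (or_introl (or_intror (ex_intro2 _ _ (existT _ h v) I erefl)) :
        B (existT _ (rep_ctx (existT _ h v)) (reps (existT _ h v))))
    | inr v => var (inr (inl (existT _ h v)))
    end.
  exact: (@type_definable_subst _ _ D B _ _ _ _ _ f DB (Ddef _ (set_mem (valP h)))).
have T2B : type_definable_over B T2.
  pose f (u : hvar P + hvar P) : term cz (sum_ctx c u) :=
    match u with
    | inl v => @Var _ _ cz (inr (inr v))
    | inr v => @Var _ _ cz (inl (inr v))
    end.
  apply: (@type_definable_reindex _ _ B _ _ _ _ (concatenated E) f).
  by apply: type_definable_sub BEE; exact: subsetUr.
have T3B : type_definable_over B T3.
  apply: type_definable_bigcap => Y DY; apply: definable_type_definable.
  apply: definable_setU; last first.
    exact: (@definable_subst _ _ D B _ _ _ _ _ (fun u => var (inr u)) DB DY).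
  apply: definable_setC.
  pose f u : term (pctx cz (B := B)) (cw u) :=
    match u with
    | inl hv => param cz (or_introl (or_intror (ex_intro2 _ _ hv I erefl)) :
        B (existT _ (rep_ctx hv) (reps hv)))
    | inr v => var (inl (inl v))
    end.
  have := @definable_subst _ _ D B _ _ _ _ _ f DB DY.
  congr definable; apply/seteqP; split=> z /=; congr Y;
    by apply: functional_extensionality_dep => -[].
pose T := T1 `&` (T2 `&` T3).
have TB : type_definable K T.
  by exists B => //; do 2?apply: type_definable_setI.
have [_ reps_s _] := A_small.
have /(_ (small_sum Klim Vs Vs) (small_sum Klim reps_s Vs)) :=
  type_definable_proj Klim Msat _ _ TB.
congr type_definable; apply/seteqP; split=> z /=.
  move=> [w [Tw1 [Tw2 Tw3]]].
  pose b : assignment M c := fun v => z (inl v).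
  (* The automorphism realizing the equality of types fixes [A] because [T1] keeps each
     representative in its class. *)
  have [Y DY Yb|s sD sE] := @equal_type_automorphism_over _ _ _ Klim Mhom D _ _
      (join_asg reps b) w Ds (small_sum Klim reps_s Vs).
    by case: (Tw3 _ DY).
  have sb : act s b = fun v => w (inr v).
    by rewrite -sE.
  have sA : fixes A s.
    apply: (@fixes_sufficient D) => // h Ah.
    have := Tw1 (SigSub (mem_set Ah)) I; rewrite /= -sE.
    by [].
  have Esb : E (act s b, fun v => z (inr v)) by rewrite sb; exact: Tw2.
  split; last by exists s.
  have [s' [sK Ks]] := automorphism_inverse s.
  rewrite /= -[fun v => _]/b -(actK sK b); apply: hset_act.
    exact: fixes_inverse sA.
  by case/hrel_sub: Esb.
move=> [/= Xb [s sA sE]].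
pose b : assignment M c := fun v => z (inl v).
(* The images under [s] have the required type over [D] because [Aut(M/A)] fixes [D] pointwise. *)
exists (join_asg (act s reps) (act s b)); split; last split.
- move=> h _ /=.
  have Ah := set_mem (valP h).
  apply/(quotient_hrel _ (mem_rep _)).
  by rewrite -(sA _ Ah); exists (rep (projT2 (val h))) => //; exact: mem_rep.
- exact: sE.
- move=> Y DY; have [Yb|] := pselect (Y (join_asg reps b)); last by left.
  right; rewrite /= (_ : (fun u => _) = act s (join_asg reps b)).
    by apply/(definable_act _ DY) => //; exact: Dfix.
  by apply: functional_extensionality_dep => -[].
Qed.

Lemma common_parameters : exists2 B : set (element M), small K B &
  forall s : automorphism M,
    (forall d, B d -> s _ (tagged d) = tagged d) -> fixes A s.
Proof.
have [D [Ds _ _ Dsuff]] := fixing_parameters.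
by exists (D `|` entries reps) => //; exact: small_parameter_set.
Qed.

Lemma preimage1P (C : set (quotient P)) x a :
  sval x a -> (preimage1 C a <-> C x).
Proof.
by move=> xa; split=> [[y Cy ya]|Cx]; [rewrite (quotient_inj xa ya)|exists x].
Qed.

Lemma preimage1_hset (C : set (quotient P)) : preimage1 C `<=` X.
Proof. by move=> a [x _ /quotient_hset]. Qed.

Lemma logic_closed_conj (C : set (quotient P)) x y :
  logic_closed A C -> same_tp A (x, y) -> C x -> C y.
Proof.
move=> [_ /invariantP Cinv].
move=> /(same_tpP (mem_rep x) (mem_rep y))[_ [s sA sE]] Cx.
have := Cinv s sA _ ((preimage1P _ (mem_rep x)).2 Cx).
have yE : sval y (act s (rep x)).
  by apply/(quotient_hrel _ (mem_rep y)); exact: hrel_sym.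
by move/(preimage1P _ yE).
Qed.

Definition conj_saturation (Z : set (assignment M c)) : set (assignment M c) :=
  [set b | exists2 b', Z b' & Theta (b, b')].

(** The saturation is the projection of [Theta] restricted to second coordinates in [Z]; as a union
    of [Theta]-classes it is invariant under [Aut(M/A)]. *)
Lemma logic_closed_saturation (Z : set (assignment M c)) : type_definable K Z ->
  exists2 C, logic_closed A C & forall x a, sval x a -> (C x <-> conj_saturation Z a).
Proof.
move=> [BZ BZs Zdef].
pose C : set (quotient P) := [set x | conj_saturation Z (rep x)].
have CP x a : sval x a -> (C x <-> conj_saturation Z a).
  move=> xa; have xaT := (same_tpP xa (mem_rep x)).1 erefl.
  split=> [[b Zb xb]|[b Zb ab]]; exists b => //.
    exact: conj_rel_trans xb.
  by apply: conj_rel_trans ab; exact: conj_rel_sym.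
exists C => //.
have e : preimage1 C = conj_saturation Z.
  apply/seteqP; split=> [a [x Cx xa]|a Za]; first exact/(CP _ _ xa).
  have [x xa] : exists x : quotient P, sval x a.
    by apply: quotient_class; case: Za => b _ /conj_rel_hset[].
  by exists x => //; apply/(CP _ _ xa).
split; rewrite e; last first.
  apply/invariantP => s sA a [b Zb ab]; exists b => //.
  have [Xa _] := conj_rel_hset ab.
  by apply: conj_rel_trans ab; apply: conj_rel_sym; exact: conj_rel_act.
have [BT BTs Tdef] := type_definable_conj_rel.
pose T : set (assignment M (sum_ctx c)) :=
  concatenated Theta `&` [set z | Z (fun v => z (inr v))].
have TB : type_definable K T.
  exists (BT `|` BZ); first exact: small_setU.
  apply: type_definable_setI.
    by apply: type_definable_sub Tdef; exact: subsetUl.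
  apply: (@type_definable_reindex _ _ _ _ _ c (sum_ctx c) Z
     (fun v => @Var _ _ (sum_ctx c) (inr v))).
  by apply: type_definable_sub Zdef; exact: subsetUr.
have := type_definable_proj Klim Msat Vs Vs TB.
congr type_definable; apply/seteqP; split=> a [b].
  by move=> [ab Zb]; exists b.
by move=> Zb ab; exists b.
Qed.

Lemma logic_separation (x y : quotient P) : ~ same_tp A (x, y) ->
  exists2 N, logic_nbhs A x N & logic_nbhs A y (~` N).
Proof.
move=> nxy.
have [BT BTs Tdef] := type_definable_conj_rel.
pose B1 := BT `|` (entries (rep x) `|` entries (rep y)).
have B1s : small K B1 by do 2?apply: small_setU => //; exact: small_entries.
have fiber_def a : entries a `<=` B1 -> type_definable_over B1 [set b | Theta (a, b)].
  move=> aB1.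
  pose f (u : hvar P + hvar P) : term (pctx c (B := B1)) (sum_ctx c u) :=
    match u with
    | inl v => param c (aB1 _ (ex_intro2 _ _ v I erefl))
    | inr v => @Var _ _ (pctx c (B := B1)) (inl v)
    end.
  exact: (@type_definable_subst _ _ BT B1 _ _ _ _ _ f (@subsetUl _ _ _) Tdef).
have [|||Z [Zdef xZ yZ]] := @type_definable_separation _ _ _ Klim Msat B1 _ _
    [set b | Theta (rep x, b)] [set b | Theta (rep y, b)] B1s Vs.
- by apply: fiber_def => d xd; right; left.
- by apply: fiber_def => d yd; right; right.
- apply/seteqP; split=> // b [xb yb]; apply: nxy.
  apply/(same_tpP (mem_rep x) (mem_rep y)); apply: conj_rel_trans xb _.
  exact: conj_rel_sym.
have def_sat (W : set (assignment M c)) : definable B1 W -> type_definable K W.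
  by move=> B1W; exists B1 => //; exact: definable_type_definable.
have [C Ccl CP] := logic_closed_saturation (def_sat _ (definable_setC Zdef)).
have [D Dcl DP] := logic_closed_saturation (def_sat _ Zdef).
(* The class of [rep x] lies inside [Z] and that of [rep y] outside. Every representative is in [Z]
   or not, so [C] and [D] cover [P] and their complements are disjoint. *)
have nCx : ~ C x by move=> /(CP _ _ (mem_rep x))[b nZb /xZ].
have nDy : ~ D y by move=> /(DP _ _ (mem_rep y))[b Zb /yZ].
exists (~` C); first by exists (~` C); split=> //; rewrite /logic_open setCK.
exists (~` D); split=> //; first by rewrite /logic_open setCK.
move=> z nDz; rewrite setCK; apply/(CP _ _ (mem_rep z)).
exists (rep z); last by apply: conj_rel_refl; exact: rep_hset.
move=> Zz; apply: nDz; apply/(DP _ _ (mem_rep z)); exists (rep z) => //.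
by apply: conj_rel_refl; exact: rep_hset.
Qed.

(** * Closed sets over a common set of parameters *)

Section CommonParameters.
Variable B : set (element M).
Hypotheses (Bs : small K B) (B_fixes : forall s : automorphism M,
  (forall d, B d -> s _ (tagged d) = tagged d) -> fixes A s).

Lemma logic_closedP (C : set (quotient P)) :
  logic_closed A C <-> type_definable_over B (preimage1 C) /\
    forall s, fixes A s -> forall a, preimage1 C a -> preimage1 C (act s a).
Proof.
split=> [[Cdef /invariantP Cinv]|[Cdef Cinv]]; last first.
  by split; [exists B|exact/invariantP].
split=> //; apply: (type_definable_invariant Klim Msat Mhom Bs Vs Cdef) => s.
by move=> /B_fixes/Cinv.
Qed.

Lemma type_definable_hset : type_definable_over B X.
Proof.
apply: (type_definable_invariant Klim Msat Mhom Bs Vs) => [|s]; first exact: hset_def.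
by move=> /B_fixes sA a; exact: hset_act.
Qed.

Lemma logic_closed_set0 : logic_closed A (set0 : set (quotient P)).
Proof.
have e : preimage1 (set0 : set (quotient P)) = set0.
  by apply/seteqP; split=> // a [].
apply/logic_closedP; rewrite e; split=> //.
by apply: definable_type_definable; exact: definable_set0.
Qed.

Lemma logic_closed_setU (C D : set (quotient P)) :
  logic_closed A C -> logic_closed A D -> logic_closed A (C `|` D).
Proof.
move=> /logic_closedP[Cdef Cinv] /logic_closedP[Ddef Dinv].
have e : preimage1 (C `|` D) = preimage1 C `|` preimage1 D.
  apply/seteqP; split=> [a [x [Cx|Dx] xa]|a [[x Cx xa]|[x Dx xa]]].
  - by left; exists x.
  - by right; exists x.
  - by exists x => //; left.
  - by exists x => //; right.
apply/logic_closedP; rewrite e; split; first exact: type_definable_setU.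
by move=> s sA a [/(Cinv _ sA)|/(Dinv _ sA)]; [left|right].
Qed.

Lemma logic_closed_bigcap (I : Type) (C : I -> set (quotient P)) :
  (forall i, logic_closed A (C i)) -> logic_closed A (\bigcap_i C i).
Proof.
(* The factor [X] is there for an empty index type [I]. *)
move=> Ccl; have e : preimage1 (\bigcap_i C i) = X `&` \bigcap_i preimage1 (C i).
  apply/seteqP; split=> [a [x Cx xa]|a [/quotient_class[x xa] Ca]].
    split; first exact: quotient_hset xa.
    by move=> i _; exists x => //; exact: Cx.
  by exists x => // i _; apply/(preimage1P _ xa)/Ca.
apply/logic_closedP; rewrite e; split.
  apply: type_definable_setI; first exact: type_definable_hset.
  by apply: type_definable_bigcap => i _; have /logic_closedP[] := Ccl i.
move=> s sA a [Xa Ca]; split; first exact: hset_act.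
by move=> i _; have /logic_closedP[_ Cinv] := Ccl i; apply: Cinv => //; exact: Ca.
Qed.

Lemma logic_compact (F : set_system (quotient P)) : ProperFilter F ->
  exists x, forall C, F C -> logic_closed A C -> C x.
Proof.
move=> FF.
(* [X] is added so that the realization represents a point of [P]. *)
pose H := [set preimage1 C | C in [set C | F C /\ logic_closed A C]] `|` [set X].
have [_ [[C [_ /logic_closedP[+ _]] <-]|->]|G Gfin GH|b bH] :=
    @type_definable_compact _ _ _ Klim Msat B _ _ H Bs Vs.
- by [].
- exact: type_definable_hset.
- have /finite_set_list[l lG] := Gfin.
  have : exists2 C, F C & forall Y, List.In Y l -> preimage1 C `<=` Y.
    have : forall Y, List.In Y l -> H Y by move=> Y /lG/GH.
    elim: l {lG} => [_|Y l IHl lH]; first by exists setT => //; exact: filterT.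
    have [C FC CP] := IHl (fun Z lZ => lH Z (or_intror lZ)).
    have [[D [FD _] DY]|XY] := lH Y (or_introl erefl).
      exists (C `&` D); first exact: filterI.
      move=> Z [<-|lZ] a [x [Cx Dx] xa]; first by rewrite -DY; exists x.
      by apply: (CP Z lZ); exists x.
    exists C => // Z [<-|/CP//]; rewrite XY; exact: preimage1_hset.
  move=> [C /filter_ex[x Cx] CG]; exists (rep x) => Y /lG lY.
  by apply: (CG Y lY); exists x => //; exact: mem_rep.
have [x xb] : exists x : quotient P, sval x b by apply: quotient_class; apply: bH; right.
exists x => C FC Ccl; apply/(preimage1P _ xb); apply: bH.
by left; exists C.
Qed.

End CommonParameters.

Lemma logic_openT : logic_open A (setT : set (quotient P)).
Proof.
have [B Bs B_fixes] := common_parameters.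
by rewrite /logic_open setCT; exact: (logic_closed_set0 Bs B_fixes).
Qed.

Lemma logic_openI : setI_closed (@logic_open L K M A P).
Proof.
have [B Bs B_fixes] := common_parameters => O O' Oop O'op.
by rewrite /logic_open setCI; exact: (logic_closed_setU Bs B_fixes).
Qed.

Lemma logic_open_bigU (I : Type) (O : I -> set (quotient P)) :
  (forall i, logic_open A (O i)) -> logic_open A (\bigcup_i O i).
Proof.
have [B Bs B_fixes] := common_parameters => Oop.
by rewrite /logic_open setC_bigcup; exact: (logic_closed_bigcap Bs B_fixes).
Qed.

Definition logic_space : topologicalType :=
  HB.pack (quotient P) (gen_eqMixin (quotient P)) (gen_choiceMixin (quotient P))
    (isOpenTopological.Build (quotient P) logic_openT logic_openI logic_open_bigU).

Lemma logic_space_compact : compact [set: logic_space].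
Proof.
have [B Bs B_fixes] := common_parameters => F FF _.
have [x xP] := @logic_compact B Bs B_fixes F FF.
exists x; split=> // N U FN [O [Oop Ox OU]].
apply: contrapT => NU; have : (~` O) x; last by apply.
apply: xP => //; apply: filterS FN => z Nz Oz; apply: NU; exists z; split=> //.
exact: OU.
Qed.

(** Closed sets are unions of types, and distinct types are separated. *)
Lemma same_tp_nbhs (x y : logic_space) : same_tp A (x, y) <-> nbhs x = nbhs y.
Proof.
have [B Bs B_fixes] := common_parameters.
have sub (u v : logic_space) : same_tp A (u, v) -> nbhs v `<=` nbhs u.
  move=> uv N [O [Oop Ov ON]]; exists O; split=> //; apply: contrapT => nOu.
  exact: (logic_closed_conj Oop uv nOu).
split=> [xy|xy].
  apply/seteqP; split; last exact: sub.
  by apply: sub; exact: esym xy.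
apply: contrapT => /logic_separation[N xN yN].
have : nbhs x (N `&` ~` N) by apply: filterI => //; rewrite xy.
by rewrite setICr => /nbhs_singleton.
Qed.

Lemma logic_space_preregular : preregular logic_space.
Proof.
have [B Bs B_fixes] := common_parameters => x y nxy.
by apply: logic_separation => /same_tp_nbhs.
Qed.

Lemma same_tp_indistinguishable : same_tp A (P := P) = indistinguishable logic_space.
Proof. by apply/seteqP; split=> -[x y] /same_tp_nbhs. Qed.

Lemma positive_relP (D : set (quotient P * quotient P)) :
  positive_rel A D <-> inf_definable2 A D /\ @indistinguishable_nbhs logic_space D.
Proof. by rewrite /positive_rel same_tp_indistinguishable. Qed.

Lemma closed_inf_definable2 (D : set (logic_space * logic_space)) :
  closed D -> @inf_definable2 L K M A P D.
Proof.
move=> Dcl; have [B Bs B_fixes] := common_parameters.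
(* The complement of [D] is a union of open boxes; avoiding a box means lying in the union of the
   cylinders over the complements of its sides. *)
pose boxes := [set CC : set (quotient P) * set (quotient P) |
  [/\ logic_closed A CC.1, logic_closed A CC.2 &
      D `<=` (fst @^-1` CC.1) `|` (snd @^-1` CC.2)]].
have DE x y : D (x, y) <-> forall CC, boxes CC -> CC.1 x \/ CC.2 y.
  split=> [Dxy CC [_ _ /(_ _ Dxy)]//|xy].
  apply: Dcl => N [[U V] [/= [O [Oop Ox OU]] [O' [O'op O'y OV]]] UVN].
  apply: contrapT => DN; have [|//|//] := xy (~` O, ~` O').
  split=> // -[u v] Duv.
  have [Ou|nOu] := pselect (O u); last by left.
  right=> O'v; apply: DN; exists (u, v); split=> //; apply: UVN.
  by split; [exact: OU|exact: OV].
have preD : concatenated (preimage2 D) =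
    [set z | X (fun v => z (inl v))] `&` ([set z | X (fun v => z (inr v))] `&`
    \bigcap_(CC in boxes) ([set z | preimage1 CC.1 (fun v => z (inl v))] `|`
                           [set z | preimage1 CC.2 (fun v => z (inr v))])).
  apply/seteqP; split=> z.
    move=> [[x y] /= Dxy [xz yz]]; split; first exact: quotient_hset xz.
    split=> [|CC bCC]; first exact: quotient_hset yz.
    by case: ((DE x y).1 Dxy CC bCC) => ?; [left; exists x|right; exists y].
  move=> [/= /quotient_class[x xz] [/quotient_class[y yz] zD]].
  exists (x, y) => //; apply/DE => CC bCC.
  by case: (zD CC bCC) => /=; [move/(preimage1P _ xz); left|move/(preimage1P _ yz); right].
have Xdef := type_definable_hset Bs B_fixes.
have inlB (Y : set (assignment M c)) : type_definable_over B Y ->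
    type_definable_over B [set z : assignment M (sum_ctx c) | Y (fun v => z (inl v))].
  exact: (@type_definable_reindex _ _ B _ _ c (sum_ctx c) Y
    (fun v => @Var _ _ (sum_ctx c) (inl v))).
have inrB (Y : set (assignment M c)) : type_definable_over B Y ->
    type_definable_over B [set z : assignment M (sum_ctx c) | Y (fun v => z (inr v))].
  exact: (@type_definable_reindex _ _ B _ _ c (sum_ctx c) Y
    (fun v => @Var _ _ (sum_ctx c) (inr v))).
split.
  exists B => //; rewrite preD; apply: type_definable_setI; first exact: inlB.
  apply: type_definable_setI; first exact: inrB.
  apply: type_definable_bigcap => CC [/(logic_closedP Bs B_fixes)[C1 _]].
  move=> /(logic_closedP Bs B_fixes)[C2 _] _.
  by apply: type_definable_setU; [exact: inlB|exact: inrB].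
apply/invariant2P => s sA a b [[x y] /= Dxy [xa yb]].
have Xa := quotient_hset xa; have Xb := quotient_hset yb.
(* The images represent points with the types of [x] and [y], which lie in the same closed sets. *)
have [x' x'a] := quotient_class (hset_act sA Xa).
have [y' y'b] := quotient_class (hset_act sA Xb).
exists (x', y') => //; apply/DE => CC bCC; have [C1 C2 _] := bCC.
have xx' := (same_tpP xa x'a).2 (conj_rel_act sA Xa).
have yy' := (same_tpP yb y'b).2 (conj_rel_act sA Xb).
case: ((DE x y).1 Dxy CC bCC) => ?; [left|right].
  exact: logic_closed_conj C1 xx' _.
exact: logic_closed_conj C2 yy' _.
Qed.

End LogicSpace.
End Hyperdefinable.

Theorem theorem1p47 (L : language) (K : Type) (M : structure L)
    (K_strong_limit : strong_limit K)
    (L_small : small K [set: symbols L])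
    (M_sat : saturated K M) (M_hom : strongly_homogeneous K M)
    (A : set (hyperimaginary K M)) (A_small : small_parameters A)
    (P : hyperdefinable K M) (P_over_A : hyperdefinable_over A P) :
  exists Phi : set_system (quotient P * quotient P),
    [/\ uniform_structure Phi,
        induces Phi (@logic_open L K M A P),
        forall Psi : set_system (quotient P * quotient P),
          uniform_structure Psi -> induces Psi (@logic_open L K M A P) ->
          Psi = Phi &
        uniformity_base Phi (@positive_rel L K M A P)].
Proof.
pose T := logic_space K_strong_limit M_sat M_hom A_small P_over_A.
have Tco : compact [set: T] by exact: logic_space_compact.
have Tpre : preregular T by exact: logic_space_preregular.
exists (@indistinguishable_nbhs T); split.
- exact: indistinguishable_nbhs_uniform Tco Tpre.
- apply: (@nbhs_induces T); exact: indistinguishable_nbhs_nbhs.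
- move=> Psi Psi_unif /(@induces_nbhs T _ Psi_unif) Psi_nbhs.
  have [? ? ? ?] := Psi_unif.
  exact: (@uniform_indistinguishable_nbhs T).
split=> [D /(positive_relP K_strong_limit M_sat M_hom A_small P_over_A)[]//|U PU].
have [V [PV Vcl VU]] := indistinguishable_nbhs_closed_base Tco Tpre PU.
exists V => //; apply/(positive_relP K_strong_limit M_sat M_hom A_small P_over_A).
by split=> //; exact: closed_inf_definable2 Vcl.
Qed.
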